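(* Let $k\ge 1$ be an integer and let $G$ be a simple planar graph of order $n$ with maximum degree $n-1$ which does not contain $k$ pairwise edge-disjoint cycles. Then $e(G)\le n+3k-4$, with equality if and only if $G\cong K_1\nabla H$, where $H$ is a graph on $n-1$ vertices with $t(H)=k-1$ and every non-trivial connected component of $H$ is a triangle-cactus.
   Context: All graphs are finite and simple. $e(G)$ is the number of edges and $t(H)$ the number of triangles of a graph. A block is a maximal connected subgraph without cut vertices. A triangle-cactus is a connected graph each of whose blocks is a triangle. For vertex-disjoint graphs $G_1,G_2$, the join $G_1\nabla G_2$ is obtained from their disjoint union by joining every vertex of $G_1$ to every vertex of $G_2$. A non-trivial component is a component with at least one edge. *)

(* Defs.v *)
From Stdlib Require Import Reals.
From mathcomp Require Import all_boot.

Set Implicit Arguments.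
Unset Strict Implicit.
Unset Printing Implicit Defensive.

Section Graphs.
Variable T : finType.
Variable e : rel T.

Definition simple_graph : Prop := symmetric e /\ irreflexive e.

Definition edge_set : {set {set T}} :=
  [set [set x.1; x.2] | x in [pred x : T * T | e x.1 x.2]].

Definition num_edges : nat := #|edge_set|.

Definition degree (v : T) : nat := #|[set u | e v u]|.

(** Planarity: a drawing in R^2 where vertices are distinct points and each
    edge xy is a simple arc (continuous injective image of [0,1]) from p x to
    p y whose interior avoids all vertex points and the interiors of the arcs
    of all other edges.  Arcs are given as continuous maps R -> R*R; only their
    restriction to [0,1] matters (any continuous map on [0,1] extends). *)
Definition planar : Prop :=
  exists (p : T -> (R * R)%type) (g : T -> T -> R -> (R * R)%type),
    injective p /\
    forall x y, e x y ->
      [/\ continuity (fun t => fst (g x y t)) /\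
          continuity (fun t => snd (g x y t)),
          g x y R0 = p x /\ g x y R1 = p y,
          (forall s t, Rle R0 s /\ Rle s R1 -> Rle R0 t /\ Rle t R1 -> g x y s = g x y t -> s = t),
          (forall t z, Rlt R0 t /\ Rlt t R1 -> g x y t <> p z) &
          (forall x' y', e x' y' -> [set x; y] != [set x'; y'] ->
             forall s t, Rlt R0 s /\ Rlt s R1 -> Rlt R0 t /\ Rlt t R1 -> g x y s <> g x' y' t)].

Definition is_cycle (s : seq T) : bool := [&& uniq s, 2 < size s & cycle e s].

Definition cycle_edges (s : seq T) : {set {set T}} :=
  [set [set p.1; p.2] | p in zip s (rot 1 s)].

Definition has_edge_disjoint_cycles (k : nat) : Prop :=
  exists C : 'I_k -> seq T,
    (forall i, is_cycle (C i)) /\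
    (forall i j, i != j -> [disjoint cycle_edges (C i) & cycle_edges (C j)]).

Definition grel_on (S : {set T}) : rel T :=
  [rel x y | [&& x \in S, y \in S & e x y]].

Definition connected_on (S : {set T}) : Prop :=
  forall x y, x \in S -> y \in S -> connect (grel_on S) x y.

Definition no_cut_vertex_on (S : {set T}) : Prop :=
  forall x, x \in S -> connected_on (S :\ x).

(** S spans a block of G[W]: a maximal connected subgraph without cut vertices
    (blocks are induced, so maximality over vertex sets suffices). *)
Definition block_on (W S : {set T}) : Prop :=
  [/\ S \subset W, S != set0, connected_on S, no_cut_vertex_on S &
      forall S' : {set T}, S \subset S' -> S' \subset W -> connected_on S' ->
                 no_cut_vertex_on S' -> S' = S].

Definition is_triangle (S : {set T}) : Prop :=
  #|S| = 3 /\ forall x y, x \in S -> y \in S -> x != y -> e x y.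

Definition num_triangles_on (W : {set T}) : nat :=
  #|[set S : {set T} | [&& S \subset W, #|S| == 3 &
        [forall x in S, forall y in S, (x != y) ==> e x y]]]|.

Definition triangle_cactus_on (C : {set T}) : Prop :=
  connected_on C /\ forall S, block_on C S -> is_triangle S.

Definition component_on (W : {set T}) (x : T) : {set T} :=
  [set y in W | connect (grel_on W) x y].

Definition nontrivial_components_cactus (W : {set T}) : Prop :=
  forall x, x \in W ->
    (exists y z, [&& y \in component_on W x, z \in component_on W x & e y z]) ->
    triangle_cactus_on (component_on W x).

End Graphs.

(* Main.v *)
(** Let [v] be a vertex adjacent to all others and [H = G - v], so that
    [e(G) = n - 1 + e(H)].  Choose a maximal family of edge-disjoint triangles
    of [H]; the remaining edges of [H] form a triangle-free graph [h].

    If [h] is nonempty it is outerplanar and triangle-free, so a nontrivial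
    component with vertex set [S] has at most [(3|S| - 4)/2] edges, while
    pairing up vertices in a spanning tree gives [|S|/2] (rounded down)
    edge-disjoint paths with distinct ends, each closed into a cycle through
    [v].  Hence [h] contributes more than [e(h)/3] cycles.

    If [h] is empty, [H] is an edge-disjoint union of [t] triangles.  Let [c] be
    a shortest cycle of [H] that is not one of them.  Each of its edges [x x']
    lies in a triangle [x x' y_x], and minimality makes the [y_x] distinct and
    off [c].  Replacing these triangles by the triangles [v x y_x] and adding
    [c] gives [t + 1] edge-disjoint cycles.  If there is no such cycle, every
    block of [H] is a triangle.

    Planarity is used only through a mod 2 winding number, with no Jordan curve
    theorem: for independent edges [ab], [cd] with arcs [f], [g], the map
    [f(s) - g(t)] does not vanish on the unit square, so the half turns of its
    direction along the boundary sum to zero mod 2.  This relates the half turns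
    of [f] seen from [c], [d] and those of [g] seen from [a], [b].  Summing such
    relations shows that each edge [ab] of [H] splits the other vertices of [H]
    into two sides (the parity of the winding number of the triangle [v a b])
    with no edge across, and that among three neighbours of [a] one edge
    separates the other two; the edge bound follows by splitting along such
    edges. *)

Require Import Defs.
From Stdlib Require Import Reals Ring Lra Classical ClassicalEpsilon.
From Coquelicot Require Compactness.
From mathcomp Require Import all_boot.
From mathcomp Require Import zify.

Set Implicit Arguments.
Unset Strict Implicit.
Unset Printing Implicit Defensive.

(** * Half turns along arcs *)

Definition vsub (p q : R * R) : R * R := (Rminus p.1 q.1, Rminus p.2 q.2).

(** Half-open, so that exactly one of [p] and [- p] is upper when [p <> 0]. *)
Definition upper (p : R * R) : bool :=
  if Rlt_dec 0 p.2 then true else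
  if Rlt_dec p.2 0 then false else
  if Rlt_dec 0 p.1 then true else false.

(** Whether a short step from [p] to [q] crosses the negative first axis. *)
Definition crosses (p q : R * R) : bool :=
  (upper p (+) upper q) && (if Rlt_dec p.1 0 then true else false).

(** The first Boolean picks the coordinate, the second its sign. The four open half-planes cover the
    plane without the origin, and inside one of them [crosses] depends only on the [upper] values of
    the two ends. *)
Definition half_plane (s : bool * bool) (p : R * R) : Prop :=
  match s with
  | (true, true) => Rlt 0 p.2
  | (true, false) => Rlt p.2 0
  | (false, true) => Rlt 0 p.1
  | (false, false) => Rlt p.1 0
  end.

Lemma upper_vertical s p : half_plane (true, s) p -> upper p = s.
Proof.
by rewrite /upper; case: s => /= H; (do !case: Rlt_dec => //=) => *; exfalso; lra.
Qed.

Lemma crosses_half s p q : half_plane s p -> half_plane s q ->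
  crosses p q = ((~~ s.1 && ~~ s.2) && (upper p (+) upper q)).
Proof.
case: s => [[] s] Hp Hq.
  by rewrite /crosses (upper_vertical Hp) (upper_vertical Hq) addbb.
rewrite /crosses; case: s Hp Hq => /= Hp Hq; case: Rlt_dec => // H /=.
- by exfalso; lra.
- by rewrite andbF.
- by rewrite andbT.
Qed.

Lemma upper_opp p q : p <> q -> upper (vsub p q) = ~~ upper (vsub q p).
Proof.
case: p q => [a b] [c d] ne; rewrite /upper /=.
do !case: Rlt_dec => //= *; try by exfalso; lra.
exfalso; apply: ne.
have -> : a = c by lra.
by have -> : b = d by lra.
Qed.

(** Negation exchanges the left and right half-planes. On either of these a change of [upper] is a
    crossing for exactly one of the step and its negative; on the other two half-planes [upper] is
    constant and neither crosses. *)
Lemma crosses_opp s p q p' q' : half_plane s (vsub p q) ->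
  half_plane s (vsub p' q') ->
  crosses (vsub q p) (vsub q' p') =
  crosses (vsub p q) (vsub p' q') (+) upper (vsub p q) (+) upper (vsub p' q').
Proof.
move=> H H'.
have opp_half u w : half_plane s (vsub u w) -> half_plane (s.1, ~~ s.2) (vsub w u).
  by case: s {H H'} => [[] []] /=; lra.
have neq u w : half_plane s (vsub u w) -> u <> w.
  by move=> Huw E; move: Huw; rewrite E; case: (s) => [[] []] /=; lra.
rewrite (crosses_half (opp_half _ _ H) (opp_half _ _ H')) (crosses_half H H') /=.
rewrite (upper_opp (nesym (neq _ _ H))) (upper_opp (nesym (neq _ _ H'))) negbK.
case: s H H' {opp_half neq} => [[] s] H H' /=.
  by rewrite (upper_vertical H) (upper_vertical H') addbb.
by case: s {H H'}; case: upper; case: upper.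
Qed.

(** A mod 2 Stokes formula: [A i j] and [B i j] sit on the two edges leaving the grid point (i, j),
    and every interior edge belongs to two cells and cancels. *)
Lemma grid_boundary (n : nat) (A B : nat -> nat -> bool) :
  (forall i j, i < n -> j < n ->
     A i j (+) B i.+1 j (+) A i j.+1 (+) B i j = false) ->
  \big[addb/false]_(i < n) A i 0 (+) \big[addb/false]_(i < n) A i n (+)
  \big[addb/false]_(j < n) B 0 j (+) \big[addb/false]_(j < n) B n j = false.
Proof.
move=> cell.
have row j : j < n -> forall m, m <= n ->
    \big[addb/false]_(i < m) A i j (+) \big[addb/false]_(i < m) A i j.+1 =
    B 0 j (+) B m j.
  move=> jn; elim=> [|m IH] mn; first by rewrite !big_ord0 !addbb.
  rewrite !big_ord_recr /=; have := cell m j mn jn.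
  move: (IH (ltnW mn)); move: (\big[_/_]_(i < m) _) (\big[_/_]_(i < m) _) => u w.
  by case: u; case: w; case: (B 0 j); case: (B m j); case: (B m.+1 j);
     case: (A m j); case: (A m j.+1).
have col m : m <= n ->
    \big[addb/false]_(i < n) A i 0 (+) \big[addb/false]_(i < n) A i m =
    \big[addb/false]_(j < m) B 0 j (+) \big[addb/false]_(j < m) B n j.
  elim: m => [|m IH] mn; first by rewrite !big_ord0 !addbb.
  rewrite !(big_ord_recr m) /=; move: (IH (ltnW mn)) (row m mn n (leqnn n)).
  case: (B 0 m); case: (B n m); do 5!case: (\big[_/_]_(_ < _) _) => //.
have := col n (leqnn n); by do 4!case: (\big[_/_]_(_ < _) _).
Qed.

Definition grid_good (n : nat) (F : R -> R -> R * R) : Prop :=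
  forall i j, i < n -> j < n -> exists s,
    let x k := Rdiv (INR k) (INR n) in
    [/\ half_plane s (F (x i) (x j)), half_plane s (F (x i.+1) (x j)),
        half_plane s (F (x i) (x j.+1)) & half_plane s (F (x i.+1) (x j.+1))].

(** A Lebesgue number argument: [f u] and [g w] differ in some coordinate, so the sign of that
    difference is constant near (u, w), and compactness of the unit square makes the size of the
    neighbourhood uniform. *)
Lemma grid_good_eventually (f g : R -> R * R) :
  continuity (fun t => (f t).1) -> continuity (fun t => (f t).2) ->
  continuity (fun t => (g t).1) -> continuity (fun t => (g t).2) ->
  (forall s t, Rle R0 s /\ Rle s R1 -> Rle R0 t /\ Rle t R1 -> f s <> g t) ->
  exists n0, forall n, n0 <= n -> 0 < n -> grid_good n (fun s t => vsub (f s) (g t)).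
Proof.
move=> cf1 cf2 cg1 cg2 disj.
have pt_cont (h : R -> R) u eps : continuity h -> Rlt 0 eps ->
    exists d, Rlt 0 d /\ forall x, Rlt (Rabs (Rminus x u)) d ->
      Rlt (Rabs (Rminus (h x) (h u))) eps.
  move=> ch e0; have [d [d0 Hd]] := ch u eps e0; exists d; split=> // x xd.
  have [->|ne] := Req_dec x u; first by rewrite Rminus_diag Rabs_R0.
  by apply: Hd; do !split=> //; apply: nesym.
have loc u w : exists d : posreal, Rle 0 u /\ Rle u 1 -> Rle 0 w /\ Rle w 1 ->
    exists s, forall x y, Rlt (Rabs (Rminus x u)) d -> Rlt (Rabs (Rminus y w)) d ->
      half_plane s (vsub (f x) (g y)).
  have [[u01 w01]|no] := classic ((Rle 0 u /\ Rle u 1) /\ (Rle 0 w /\ Rle w 1)); last first.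
    by exists (mkposreal 1 Rlt_0_1) => ? ?; case: no.
  have main (a b : R -> R) : continuity a -> continuity b -> a u <> b w ->
      exists d, Rlt 0 d /\ exists s : bool, forall x y,
        Rlt (Rabs (Rminus x u)) d -> Rlt (Rabs (Rminus y w)) d ->
        if s then Rlt 0 (Rminus (a x) (b y)) else Rlt (Rminus (a x) (b y)) 0.
    move=> ca cb ne.
    have e0 : Rlt 0 (Rdiv (Rabs (Rminus (a u) (b w))) 2).
      by have ? := Rabs_pos_lt _ (Rminus_eq_contra _ _ ne); lra.
    have [d1 [d10 H1]] := pt_cont a u _ ca e0.
    have [d2 [d20 H2]] := pt_cont b w _ cb e0.
    exists (Rmin d1 d2); split; first by apply: Rmin_pos.
    exists (if Rlt_dec 0 (Rminus (a u) (b w)) then true else false) => x y xd yd.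
    have {}H1 := H1 x (Rlt_le_trans _ _ _ xd (Rmin_l _ _)).
    have {}H2 := H2 y (Rlt_le_trans _ _ _ yd (Rmin_r _ _)).
    move: H1 H2; have [lt|gt] := Rdichotomy _ _ ne; rewrite /Rabs;
    by case: Rlt_dec => ? /=; repeat case: Rcase_abs => ?; move=> ? ?; lra.
  have [E2|N2] := Req_dec (f u).2 (g w).2.
    have N1 : (f u).1 <> (g w).1.
      move=> E1; apply: (disj u w) => //.
      by rewrite (surjective_pairing (f u)) (surjective_pairing (g w)) E1 E2.
    have [d [d0 [s Hs]]] := main _ _ cf1 cg1 N1.
    exists (mkposreal d d0) => _ _; exists (false, s) => x y /= xd yd.
    by have := Hs x y xd yd; case: s {Hs}.
  have [d [d0 [s Hs]]] := main _ _ cf2 cg2 N2.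
  exists (mkposreal d d0) => _ _; exists (true, s) => x y /= xd yd.
  by have := Hs x y xd yd; case: s {Hs}.
pose del u w := proj1_sig (constructive_indefinite_description _ (loc u w)).
have Hdel u w := proj2_sig (constructive_indefinite_description _ (loc u w)).
(* The radii are halved so that a corner within 1/n of a grid point, itself within half the radius
   of (u, w), stays within the full radius. *)
have half_pos (d : posreal) : Rlt 0 (Rdiv d 2) by have ? := cond_pos d; lra.
pose del2 u w := mkposreal _ (half_pos (del u w)).
have [d Hd] := Compactness.compactness_value_2d 0 1 0 1 del2.
have [n0 Hn0] : exists n0, Rlt (Rinv d) (INR n0).
  have [m Hm] := INR_unbounded (Rinv d); by exists m; lra.
exists n0 => n n0n n_gt0 i j i_n j_n.
have n0R : Rlt 0 (INR n) by apply: lt_0_INR; apply/ltP.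
have ninv : Rlt (Rinv (INR n)) d.
  rewrite -(Rinv_inv d); apply: Rinv_lt_contravar.
    by apply: Rmult_lt_0_compat => //; apply: Rinv_0_lt_compat; apply: cond_pos.
  apply: Rlt_le_trans Hn0 _; exact/le_INR/leP.
have in01 k : k <= n -> Rle 0 (Rdiv (INR k) (INR n)) /\ Rle (Rdiv (INR k) (INR n)) 1.
  move=> kn; split; first by apply: Rle_mult_inv_pos => //; apply: pos_INR.
  apply: (Rmult_le_reg_r (INR n)) => //; rewrite /Rdiv Rmult_assoc Rinv_l ?Rmult_1_r ?Rmult_1_l; last lra.
  exact/le_INR/leP.
have step k : Rdiv (INR k.+1) (INR n) = Rplus (Rdiv (INR k) (INR n)) (Rinv (INR n)).
  by rewrite S_INR; field; lra.
have iR := in01 i (ltnW i_n); have jR := in01 j (ltnW j_n).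
have [u [w [u01 [w01 [iu [jw dd]]]]]] := NNPP _ (Hd _ _ iR jR).
have [s Hs] := Hdel u w u01 w01; exists s.
move: iu jw dd; rewrite /= -/(del u w) !step => iu jw dd.
have inv0 := Rinv_0_lt_compat _ n0R.
move: iu jw; rewrite /Rabs; do 2![case: Rcase_abs => ?] => iu jw.
all: split; apply: Hs; rewrite -/(del u w) /Rabs; case: Rcase_abs; lra.
Qed.

(** A finite sum in place of a lifted angle; it is meaningful once consecutive samples, seen from
    [z], share a half-plane. *)
Definition half_turns (n : nat) (f : R -> R * R) (z : R * R) : bool :=
  \big[addb/false]_(i < n) crosses (vsub (f (Rdiv (INR i) (INR n))) z)
                                   (vsub (f (Rdiv (INR i.+1) (INR n))) z).

Lemma addb_telescope (u : nat -> bool) n :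
  \big[addb/false]_(i < n) (u i (+) u i.+1) = u 0 (+) u n.
Proof.
elim: n => [|n IH]; first by rewrite big_ord0 addbb.
by rewrite big_ord_recr /= IH -addbA [u n (+) _]addbA addbb.
Qed.

(** Reversing the direction changes each term by the change of [upper] along the step, by
    [crosses_opp], and these changes telescope to the two ends of the arc. *)
Lemma half_turns_opp n (g : R -> R * R) (a : R * R) : 0 < n ->
  (forall j, j < n -> exists s,
     half_plane s (vsub a (g (Rdiv (INR j) (INR n)))) /\
     half_plane s (vsub a (g (Rdiv (INR j.+1) (INR n))))) ->
  \big[addb/false]_(j < n) crosses (vsub a (g (Rdiv (INR j) (INR n))))
                                   (vsub a (g (Rdiv (INR j.+1) (INR n)))) =
  half_turns n g a (+) upper (vsub a (g R0)) (+) upper (vsub a (g R1)).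
Proof.
move=> n0 good; have nR : INR n <> R0 by apply: not_0_INR => E; rewrite E in n0.
pose u j := upper (vsub a (g (Rdiv (INR j) (INR n)))).
have -> : upper (vsub a (g R0)) = u 0 by rewrite /u Rdiv_0_l.
have -> : upper (vsub a (g R1)) = u n by rewrite /u Rdiv_diag.
rewrite -addbA -addb_telescope /half_turns -big_split; apply: eq_bigr => j _.
have [s [H H']] := good j (ltn_ord j).
by rewrite (crosses_opp H H') -/(u j) -/(u j.+1); case: crosses; case: (u j); case: (u j.+1).
Qed.

(** This is [grid_boundary] for the samples of f(s) - g(t): a cell whose corners share a half-plane
    contributes zero. Two sides of the square give the half turns of [f] about the ends of [g]; the
    other two show [g] with reversed direction, whence the [upper] terms. *)
Lemma half_turns_pair n (f g : R -> R * R) : 0 < n ->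
  grid_good n (fun s t => vsub (f s) (g t)) ->
  half_turns n f (g R0) (+) half_turns n f (g R1) (+)
  half_turns n g (f R0) (+) half_turns n g (f R1) =
  upper (vsub (f R0) (g R0)) (+) upper (vsub (f R0) (g R1)) (+)
  upper (vsub (f R1) (g R0)) (+) upper (vsub (f R1) (g R1)).
Proof.
move=> n0 good; have nR : INR n <> R0 by apply: not_0_INR => E; rewrite E in n0.
pose x k := Rdiv (INR k) (INR n).
have x0 : x 0 = R0 by rewrite /x Rdiv_0_l.
have xn : x n = R1 by rewrite /x Rdiv_diag.
pose F i j := vsub (f (x i)) (g (x j)).
have := @grid_boundary n (fun i j => crosses (F i j) (F i.+1 j))
  (fun i j => crosses (F i j) (F i j.+1)).
have EA j : \big[addb/false]_(i < n) crosses (F i j) (F i.+1 j) = half_turns n f (g (x j)).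
  by [].
have EB t k : t = x k -> k = 0 \/ k = n ->
    \big[addb/false]_(j < n) crosses (F k j) (F k j.+1) =
    half_turns n g (f t) (+) upper (vsub (f t) (g R0)) (+) upper (vsub (f t) (g R1)).
  move=> -> kn; rewrite -half_turns_opp // => j jn; case: kn => ->.
    by have [s [h1 _ h2 _]] := good 0 j n0 jn; exists s.
  (* Goodness is stated for cells: the last side of the square is read off the cells of column
     [n.-1]. *)
  have n1n : n.-1 < n by rewrite prednK.
  by have := good n.-1 j n1n jn; rewrite prednK // => -[s [_ h1 _ h2]]; exists s.
rewrite !EA x0 xn (EB R0 0) ?(EB R1 n) //; [|by right|by left].
move=> E; rewrite -[RHS]addFb -{}E.
  by do 4!case: half_turns; do 4!case: upper.
move=> i j iN jN; have [s [h1 h2 h3 h4]] := good i j iN jN.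
rewrite (crosses_half h1 h2) (crosses_half h2 h4) (crosses_half h3 h4) (crosses_half h1 h3).
by case: (~~ s.1 && ~~ s.2) => //=; do 4!case: upper.
Qed.

(** Here [m a b c] counts the half turns of the arc of [a b] about the point of [c], and [L]
    compares two points by [upper]. Independent edges have disjoint closed arcs, so
    [half_turns_pair] applies. *)
Lemma planar_half_turns (T : finType) (e : rel T) : planar e ->
  exists m : T -> T -> T -> bool, exists2 L : rel T,
    (forall x y, x != y -> L x y = ~~ L y x) &
    forall a b c d, e a b -> e c d -> a != c -> a != d -> b != c -> b != d ->
      m a b c (+) m a b d (+) m c d a (+) m c d b =
      L a c (+) L a d (+) L b c (+) L b d.
Proof.
case=> p [g [p_inj Hg]].
pose indep (q : T * T * (T * T)) :=
  [&& e q.1.1 q.1.2, e q.2.1 q.2.2, q.1.1 != q.2.1, q.1.1 != q.2.2, q.1.2 != q.2.1 & q.1.2 != q.2.2].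
have ev q : exists n0, indep q -> forall n, n0 <= n -> 0 < n ->
    grid_good n (fun s t => vsub (g q.1.1 q.1.2 s) (g q.2.1 q.2.2 t)).
  case: (boolP (indep q)) => [|_]; last by exists 0.
  case: q => [[a b] [c d]] /and5P[/= eab ecd ac ad /andP[bc bd]].
  have [[c1 c2] [g0 g1] _ av dj] := Hg a b eab.
  have [[c1' c2'] [g0' g1'] _ av' _] := Hg c d ecd.
  have [||||s t s01 t01 E|n0 H] := @grid_good_eventually (g a b) (g c d) => //; last first.
    by exists n0 => _; apply: H.
  have ends u : Rle R0 u /\ Rle u R1 -> [\/ u = R0, u = R1 | Rlt R0 u /\ Rlt u R1].
    move=> [u0 u1]; have [->|n0] := Req_dec u R0; first by constructor 1.
    have [->|n1] := Req_dec u R1; first by constructor 2.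
    by constructor 3; have [] := (Rdichotomy _ _ n0, Rdichotomy _ _ n1); lra.
  have neq x y : x != y -> p x <> p y by move/eqP=> ne /p_inj.
  have inner_ne : [set a; b] != [set c; d].
    apply: contraNneq ac => /setP/(_ a); rewrite !inE eqxx => /esym.
    by rewrite (negPf ad) orbF.
  case: (ends s s01) E => [->|->|s_in]; case: (ends t t01) => [->|->|t_in];
    rewrite ?g0 ?g1 ?g0' ?g1'; try exact: neq.
  - by move/esym; apply: av'.
  - by move/esym; apply: av'.
  - exact: av.
  - exact: av.
  - exact: dj.
(* There are finitely many pairs of edges, so one number [n] of samples serves them all and [m] is a
   single function. *)
have [N HN] := fin_all_exists ev.
pose n := (\max_q N q).+1.
exists (fun a b => half_turns n (g a b) \o p), (fun x y => upper (vsub (p x) (p y))) =>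
  [x y xy|a b c d eab ecd ac ad bc bd].
  by apply: upper_opp => /p_inj /eqP; apply/negP.
have [_ [g0 g1] _ _ _] := Hg a b eab; have [_ [g0' g1'] _ _ _] := Hg c d ecd.
rewrite /= -g0 -g1 -g0' -g1'; apply: half_turns_pair => //.
apply: (HN (a, b, (c, d))) => //; first by rewrite /indep /= eab ecd ac ad bc bd.
exact/leqW/leq_bigmax.
Qed.

(** * The two sides of an edge *)

Lemma addb_ring : ring_theory false true addb andb addb id eq.
Proof. by split=> //; do ?case. Qed.

Lemma eqb_ok (a b : bool) : eqb a b = true -> a = b.
Proof. by move/eqP. Qed.

Ltac bool_cst t := match t with true => true | false => false | _ => InitialRing.NotConstant end.

Add Ring addb_ring : addb_ring (decidable eqb_ok, constants [bool_cst]).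

(** Adding both sides of three equations turns a consequence of them into a plain identity of
    Boolean polynomials, which [ring] can prove. *)
Lemma addb_cancel3 l1 r1 l2 r2 l3 r3 x y : l1 = r1 -> l2 = r2 -> l3 = r3 ->
  (x (+) y) = (l1 (+) r1) (+) (l2 (+) r2) (+) (l3 (+) r3) -> x = y.
Proof. by move=> -> -> ->; rewrite !addbb; case: x; case: y. Qed.

Section Sides.
Variables (T : finType) (e : rel T) (v : T).

(** The value [w a b c] is meant as the parity of the winding number of the triangle [v a b] about
    [c]. By the second clause some edge at [a] separates the ends of the other two. *)
Definition side_function (w : T -> T -> T -> bool) : Prop :=
  (forall a b c d, e a b -> e c d -> uniq [:: v; a; b; c; d] -> w a b c = w a b d) /\
  (forall a b c d, e a b -> e a c -> e a d -> uniq [:: v; a; b; c; d] ->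
     ~~ [&& w a b c == w a b d, w a c b == w a c d & w a d b == w a d c]).

Lemma planar_sides : symmetric e -> planar e -> (forall u, u != v -> e v u) ->
  exists w, side_function w.
Proof.
move=> e_sym /planar_half_turns[m [L L_anti M]] hub.
(* The half turns of the three sides [v a], [a b], [v b] about [c]. Relating each side to an edge
   [c d] and adding, the terms [m c d _] and [L _ _] occur twice and cancel. *)
exists (fun a b c => m v a c (+) m a b c (+) m v b c); split.
  move=> a b c d eab ecd /= /and5P[]; rewrite !inE !negb_or.
  move=> /and4P[va vb vc vd] /and3P[ab ac ad] /andP[bc bd] cd _.
  have ea : e v a by apply: hub; rewrite eq_sym.
  have eb : e v b by apply: hub; rewrite eq_sym.
  apply: (addb_cancel3 (M a b c d eab ecd ac ad bc bd) (M v a c d ea ecd vc vd ac ad)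
    (M v b c d eb ecd vc vd bc bd)); ring.
move=> a b c d eab eac ead /= /and5P[]; rewrite !inE !negb_or.
move=> /and4P[va vb vc vd] /and3P[ab ac ad] /andP[bc bd] cd _.
have hubP x : v != x -> e v x by move=> vx; apply: hub; rewrite eq_sym.
(* For two neighbours [x], [y] of [a], the relations of the independent pairs [a x], [v y] and
   [a y], [v x] are added. *)
have M2 x y : e a x -> e a y -> v != x -> v != y -> a != x -> a != y -> x != y ->
    (m a x v (+) m a x y (+) m v y a (+) m v y x) (+)
    (m a y v (+) m a y x (+) m v x a (+) m v x y) =
    (L a v (+) L a y (+) L x v (+) L x y) (+) (L a v (+) L a x (+) L y v (+) L y x).
  move=> eax eay vx vy ax ay xy.
  rewrite (M a x v y) ?(M a y v x) ?hubP // eq_sym //.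
apply/and3P => -[/eqP E1 /eqP E2 /eqP E3].
(* Summed over the three pairs of neighbours, all [L] terms cancel but these. Each bracket is true
   by antisymmetry of [L], and three of them have odd sum. *)
suff : (L b c (+) L c b) (+) (L b d (+) L d b) (+) (L c d (+) L d c) = false.
  by rewrite (L_anti _ _ bc) (L_anti _ _ bd) (L_anti _ _ cd); do 3!case: (L _ _).
pose x0 := addb_cancel3 (M2 b c eab eac vb vc ab ac bc) (M2 b d eab ead vb vd ab ad bd)
    (M2 c d eac ead vc vd ac ad cd).
apply: (addb_cancel3 E1 E2 E3); rewrite -[LHS]addbF.
apply: x0; ring.
Qed.
End Sides.

(** * Triangle-free graphs *)

Ltac card_lia :=
  repeat match goal with |- context [@card ?T ?A] => move: (@card T A) => ? end; clear; lia.

Lemma edge_setP (T : finType) (r : rel T) (E : {set T}) :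
  reflect (exists x y, r x y /\ E = [set x; y]) (E \in edge_set r).
Proof.
apply: (iffP imsetP) => [[[x y] /= rxy ->]|[x [y [rxy ->]]]]; first by exists x, y.
by exists (x, y).
Qed.

Definition edges_in (T : finType) (r : rel T) (S : {set T}) : {set {set T}} :=
  [set E in edge_set r | E \subset S].

Lemma edges_inP (T : finType) (r : rel T) (S E : {set T}) :
  reflect (exists x y, [/\ r x y, x \in S, y \in S & E = [set x; y]]) (E \in edges_in r S).
Proof.
rewrite inE; apply: (iffP andP) => [[/edge_setP[x [y [rxy ->]]]]|[x [y [rxy xS yS ->]]]].
  by rewrite subUset !sub1set => /andP[xS yS]; exists x, y.
by split; [apply/edge_setP; exists x, y|rewrite subUset !sub1set xS yS].
Qed.

Lemma card_edges_in_degree (T : finType) (h : rel T) (S : {set T}) (d : nat) :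
  symmetric h -> irreflexive h ->
  (forall a, a \in S -> #|[set x in S | h a x]| <= d) -> 2 * #|edges_in h S| <= d * #|S|.
Proof.
move=> h_sym h_irr deg.
have -> : 2 * #|edges_in h S| = \sum_(E in edges_in h S) \sum_(a in S | a \in E) 1.
  rewrite mulnC -sum_nat_const; apply: eq_bigr => E /edges_inP[x [y [hxy xS yS ->]]].
  rewrite sum1_card (@eq_card _ _ (mem [set x; y])) ?cards2.
    by case: eqVneq hxy => // ->; rewrite h_irr.
  by move=> a; rewrite unfold_in /= !inE; apply: andb_idl => /orP[] /eqP->.
rewrite (exchange_big_dep (mem S)) /=; last by move=> E a _ /andP[].
rewrite mulnC -sum_nat_const; apply: leq_sum => a aS.
apply: leq_trans (deg a aS); rewrite sum1_card.
apply: leq_trans (leq_imset_card (fun x => [set a; x]) _).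
apply/subset_leq_card/subsetP => E; rewrite unfold_in aS /= => /andP[].
case/edges_inP => [x [y [hxy xS yS ->]]]; rewrite !inE => /orP[] /eqP E1; subst a.
  by apply/imsetP; exists y; rewrite ?inE ?yS.
by apply/imsetP; exists x; rewrite ?inE ?xS 1?h_sym // setUC.
Qed.

Definition triangle_free (T : finType) (h : rel T) : Prop :=
  forall x y z, h x y -> h y z -> ~~ h x z.

(** Induction on the size of [S]. An edge with vertices of [S] on both sides cuts [S] into two
    smaller sets that share only its ends. If no edge does, the second clause of [side_function]
    bounds all degrees by 2, and sets of at most three vertices are checked directly. *)
Lemma triangle_free_bound (T : finType) (e h : rel T) (v : T)
    (w : T -> T -> T -> bool) (S : {set T}) :
  symmetric h -> irreflexive h -> subrel h e -> triangle_free h -> side_function e v w ->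
  v \notin S -> 1 < #|S| -> 2 * #|edges_in h S| + 4 <= 3 * #|S|.
Proof.
move=> h_sym h_irr he tf [same_side some_side].
have [n] := ubnP #|S|; elim: n S => // n IH S Sn vS S1.
have hne x y : h x y -> x != y by apply: contraTneq => ->; rewrite h_irr.
have vne x : x \in S -> v != x by apply: contraTneq => <-.
case: (boolP [exists a in S, exists b in S, h a b &&
   [exists c in S :\ a :\ b, exists d in S :\ a :\ b, w a b c && ~~ w a b d]]).
  move=> /exists_inP[a aS /exists_inP[b bS /andP[hab /exists_inP[c cS /exists_inP[d dS /andP[wc wd]]]]]].
  move: cS dS; rewrite !inE => /and3P[cb ca cS] /and3P[db da dS].
  pose Q (s : bool) := [set x in S | (x \in [set a; b]) || (w a b x == s)].
  have aQ s : a \in Q s by rewrite !inE aS eqxx.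
  have bQ s : b \in Q s by rewrite !inE bS eqxx orbT.
  have QU : Q true :|: Q false = S.
    by apply/setP=> x; rewrite !inE -andb_orr; case: (w a b x); rewrite !(orbT, orbF, andbT).
  have QI : Q true :&: Q false = [set a; b].
    apply/setP=> x; rewrite !inE; case: (w a b x); rewrite /= ?orbT ?orbF ?andbT.
      by case: eqVneq => [->|_]; [rewrite aS|case: eqVneq => [->|_]; rewrite ?bS ?andbF].
    by case: eqVneq => [->|_]; [rewrite aS|case: eqVneq => [->|_]; rewrite ?bS ?andbF].
  have Qlt s : #|Q s| < n.
    rewrite -ltnS; apply: leq_trans Sn; rewrite ltnS; apply: proper_card; apply/properP; split.
      by apply/subsetP=> x; rewrite inE => /andP[].
    case: s; [exists d|exists c] => //; rewrite !inE.
      by rewrite (negPf da) (negPf db) (negPf wd) dS.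
    by rewrite (negPf ca) (negPf cb) wc cS.
  have Q1 s : 1 < #|Q s|.
    by rewrite (cardD1 a) (cardD1 b) !inE aS bS !eqxx /= orbT eq_sym (hne _ _ hab).
  have EU : edges_in h S \subset edges_in h (Q true) :|: edges_in h (Q false).
    apply/subsetP => E /edges_inP[x [y [hxy xS yS ->]]].
    suff [s [xQ yQ]] : exists s, x \in Q s /\ y \in Q s.
      rewrite inE; apply/orP; case: s xQ yQ => xQ yQ; [left|right]; apply/edges_inP; by exists x, y.
    case: (boolP (x \in [set a; b])) => xab.
      by exists (w a b y); move: xab; rewrite !inE xS yS eqxx => ->; rewrite !orbT.
    case: (boolP (y \in [set a; b])) => yab.
      by exists (w a b x); move: yab; rewrite !inE xS yS eqxx => ->; rewrite !orbT.
    exists (w a b x); rewrite !inE xS yS eqxx orbT; split=> //.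
    rewrite (same_side a b x y) ?eqxx ?orbT ?(he _ _ hab) ?(he _ _ hxy) //=.
    move: xab yab; rewrite !inE !negb_or => /andP[xa xb] /andP[ya yb].
    rewrite !vne // (eq_sym a x) (eq_sym a y) (eq_sym b x) (eq_sym b y) xa xb ya yb.
    by rewrite (hne _ _ hab) (hne _ _ hxy).
  have EI : [set [set a; b]] \subset edges_in h (Q true) :&: edges_in h (Q false).
    by rewrite sub1set inE; apply/andP; split; apply/edges_inP; exists a, b.
  have := cardsUI (Q true) (Q false); rewrite QU QI cards2 (hne _ _ hab) /=.
  have := cardsUI (edges_in h (Q true)) (edges_in h (Q false)).
  move: (subset_leq_card EU) (subset_leq_card EI); rewrite cards1.
  have vQ s : v \notin Q s by rewrite !inE (negPf vS).
  (* The halves have |S| + 2 vertices in total and both contain the edge [a b], so the two bounds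
     add up to exactly the one for [S]. *)
  by move: (IH _ (Qlt true) (vQ _) (Q1 true)) (IH _ (Qlt false) (vQ _) (Q1 false)); card_lia.
move=> no_split.
have sep a b c d : a \in S -> b \in S -> c \in S -> d \in S -> h a b ->
    a != c -> a != d -> b != c -> b != d ->
    w a b c = w a b d.
  move=> aS bS cS dS hab ac ad bc bd; apply: contraNeq no_split => wcd.
  apply/exists_inP; exists a => //; apply/exists_inP; exists b => //; rewrite hab /=.
  case E : (w a b c); move: wcd; rewrite E => wd.
    apply/exists_inP; exists c; first by rewrite !inE cS ![c == _]eq_sym ac bc.
    apply/exists_inP; exists d; first by rewrite !inE dS ![d == _]eq_sym ad bd.
    by rewrite E; case: (w a b d) wd.
  apply/exists_inP; exists d; first by rewrite !inE dS ![d == _]eq_sym ad bd.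
  apply/exists_inP; exists c; first by rewrite !inE cS ![c == _]eq_sym ac bc.
  by rewrite E; case: (w a b d) wd.
have deg a : a \in S -> #|[set x in S | h a x]| <= 2.
  move=> aS; rewrite leqNgt; apply/negP => /card_gt2P[b [c [d [[]]]]].
  rewrite !inE => /andP[bS hab] /andP[cS hac] /andP[dS had] [bc cd db].
  have bd : b != d by rewrite eq_sym.
  have [ab ac ad] : [/\ a != b, a != c & a != d] by rewrite !hne.
  have [cb dc] : c != b /\ d != c by rewrite eq_sym bc eq_sym.
  have := some_side a b c d (he _ _ hab) (he _ _ hac) (he _ _ had).
  rewrite /= !inE !negb_or !vne // ab ac ad bc bd cd => /(_ isT) /and3P[]; split; apply/eqP; exact: sep.
have := card_edges_in_degree h_sym h_irr deg.
have [S4|S4] := leqP 4 #|S|; first by move: S4; card_lia.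
case: (ltngtP #|S| 3) => [S2|S3|S3 _]; [|by move: S4 S3; card_lia|].
  have {S2} S2 : #|S| = 2 by move: S1 S2; card_lia.
  have : #|edges_in h S| <= 1.
    rewrite -(cards1 S); apply/subset_leq_card/subsetP => E /edges_inP[x [y [hxy xS yS ->]]].
    by rewrite inE eqEcard S2 cards2 (hne _ _ hxy) subUset !sub1set xS yS.
  by rewrite S2; card_lia.
suff : #|edges_in h S| <= 2 by rewrite S3; card_lia.
rewrite leqNgt; apply/negP => E3.
have full : edges_in h S = [set E : {set T} | E \subset S & #|E| == 2].
  apply/eqP; rewrite eqEcard; apply/andP; split.
    apply/subsetP => E /edges_inP[x [y [hxy xS yS ->]]].
    by rewrite inE cards2 hne // subUset !sub1set xS yS.
  by rewrite cards_draws S3.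
have adj x y : x \in S -> y \in S -> x != y -> h x y.
  move=> xS yS xy.
  have : [set x; y] \in edges_in h S by rewrite full inE cards2 xy subUset !sub1set xS yS.
  case/edges_inP => [a [b [hab aS bS]]] /setP E.
  move: (E x) (E y); rewrite !inE !eqxx ?orbT /=.
  move=> /esym/orP[] /eqP ? /esym/orP[] /eqP ?; subst => //; first [by rewrite eqxx in xy| by rewrite h_sym].
have /card_gt2P[b [c [d [[bS cS dS] [bc cd db]]]]] : 2 < #|S| by rewrite S3.
by have := tf b c d (adj _ _ bS cS bc) (adj _ _ cS dS cd); rewrite adj // eq_sym.
Qed.

(** * Packing cycles through the hub *)

Lemma set2_inj (T : finType) (x a b : T) : [set x; a] = [set x; b] -> a = b.
Proof.
move/setP=> E; move: (E a) (E b); rewrite !inE !eqxx ?orbT.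
move=> /esym/orP[/eqP->|/eqP//]; rewrite orbb => /eqP->; exact: erefl.
Qed.

Lemma connect_exit (T : finType) (r : rel T) (S : {set T}) x z :
  connect r x z -> x \in S -> z \notin S -> exists a b, [/\ a \in S, b \notin S & r a b].
Proof.
case/connectP => p; elim: p x => [|y p IH] x /= => [_ -> -> //|/andP[rxy rp] zE xS zS].
by have [yS|yS] := boolP (y \in S); [apply: IH rp zE yS zS|exists x, y].
Qed.

Section Packings.
Variables (T : finType) (e : rel T).

(** Confining the cycles to [F] lets packings of disjoint edge sets be concatenated, and lists suit
    that concatenation. *)
Definition packs (F : {set {set T}}) (k : nat) : Prop :=
  exists L : seq (seq T),
    [/\ size L = k, all (is_cycle e) L, all (fun s => cycle_edges s \subset F) L &
        pairwise (fun s t => [disjoint cycle_edges s & cycle_edges t]) L].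

Lemma packs0 F : packs F 0.
Proof. by exists [::]. Qed.

Lemma packs_sub (F F' : {set {set T}}) k k' : packs F k -> F \subset F' -> k' <= k -> packs F' k'.
Proof.
case=> L [sL cL FL dL] FF' kk; exists (take k' L); split.
- by rewrite size_take sL; case: ltngtP kk.
- by apply/allP => s /mem_take/(allP cL).
- by apply/allP => s /mem_take/(allP FL)/subset_trans; apply.
- exact: subseq_pairwise (take_subseq _ _) dL.
Qed.

Lemma packs_cat (F1 F2 : {set {set T}}) k1 k2 :
  packs F1 k1 -> packs F2 k2 -> [disjoint F1 & F2] -> packs (F1 :|: F2) (k1 + k2).
Proof.
case=> L1 [s1 c1 F1L d1] [L2 [s2 c2 F2L d2]] dF; exists (L1 ++ L2); split.
- by rewrite size_cat s1 s2.
- by rewrite all_cat c1 c2.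
- rewrite all_cat; apply/andP; split; [apply: sub_all F1L|apply: sub_all F2L] => s /subset_trans -> //.
    exact: subsetUl.
  exact: subsetUr.
- rewrite pairwise_cat d1 d2 !andbT; apply/allrelP => s t sL tL.
  by apply: disjointW dF; [apply: (allP F1L)|apply: (allP F2L)].
Qed.

Lemma packs_cons (F : {set {set T}}) k s :
  is_cycle e s -> cycle_edges s \subset F -> packs (F :\: cycle_edges s) k -> packs F k.+1.
Proof.
move=> cs sF pk; rewrite -add1n -(setID F (cycle_edges s)) (setIidPr sF).
apply: packs_cat => //; first by exists [:: s]; rewrite /= cs subxx.
by rewrite -setI_eq0 setDE setICA setICr setI0.
Qed.

Lemma packs_has_cycles F k : packs F k -> has_edge_disjoint_cycles e k.
Proof.
case=> L [sL /allP cL _ dL]; exists (fun i : 'I_k => nth [::] L i); split.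
  by move=> i; apply: cL; apply: mem_nth; rewrite sL.
have lt (i j : 'I_k) : i < j ->
    [disjoint cycle_edges (nth [::] L i) & cycle_edges (nth [::] L j)].
  by move=> ij; apply: (pairwiseP [::] dL) => //; rewrite inE sL.
move=> i j; rewrite -val_eqE neq_ltn => /orP[/lt //|/lt]; by rewrite disjoint_sym.
Qed.

Lemma cycle_edges_sub (F : {set {set T}}) s :
  cycle [rel x y | [set x; y] \in F] s -> cycle_edges s \subset F.
Proof.
case: s => [_|x s]; first by apply/subsetP => E /imsetP[].
rewrite /cycle /cycle_edges rot1_cons => cs.
apply/subsetP => _ /imsetP[[a b] /= ab ->].
(* The starting vertex of the path varies in the induction, while the closing vertex [x] stays
   fixed. *)
elim: s {-2 4}x cs ab => [|z s IH] y /=.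
  by rewrite andbT !inE => xF /eqP[-> ->].
by case/andP=> yz zs; rewrite inE => /orP[/eqP[-> ->] //|]; apply: IH.
Qed.

End Packings.

(** * Pairing up the vertices of a connected set *)

Section Pairings.
Variable T : finType.
Implicit Types (F A : {set {set T}}) (U S : {set T}).

(** [k] disjoint edge sets inside [F], each joining two vertices of [U], with all
    [2 * k] ends distinct; the edge sets need not be paths. *)
Fixpoint pairing F U (k : nat) : Prop :=
  if k is k'.+1 then
    exists A a b, [/\ A \subset F, a != b, a \in U, b \in U &
      connect [rel x y | [set x; y] \in A] a b] /\ pairing (F :\: A) (U :\ a :\ b) k'
  else True.

Lemma pairing_sub F F' U U' k :
  F \subset F' -> U \subset U' -> pairing F U k -> pairing F' U' k.
Proof.
elim: k F F' U U' => //= k IH F F' U U' FF UU [A [a [b [[AF ab aU bU cab] pr]]]].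
exists A, a, b; split; first by rewrite (subset_trans AF) ?(subsetP UU).
by apply: IH pr; rewrite ?setSD.
Qed.

(** The edge set that ends at [y], if there is one, is prolonged by the edge [x y]; as this edge
    lies outside [F], the others remain disjoint from it. *)
Lemma pairing_detour F U k x y : x \notin U -> [set x; y] \notin F ->
  pairing F (y |: U) k -> pairing ([set x; y] |: F) (x |: U) k.
Proof.
elim: k F U => //= k IH F U xU xyF [A [a [b [[AF ab aU bU cab] pr]]]].
have move_end c : c \in y |: U -> c != y -> connect [rel x y | [set x; y] \in A] y c ->
    pairing (F :\: A) ((y |: U) :\ y :\ c) k ->
    exists A' a b, [/\ A' \subset [set x; y] |: F, a != b, a \in x |: U, b \in x |: U &
      connect [rel x y | [set x; y] \in A'] a b] /\
      pairing (([set x; y] |: F) :\: A') ((x |: U) :\ a :\ b) k.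
  move=> cU cy yc prc; have {}cU : c \in U by move: cU; rewrite !inE (negPf cy).
  exists ([set x; y] |: A), x, c; split.
    split; rewrite ?setUS ?setU11 ?(setU1r _ cU) //.
      by apply: contraNneq xU => ->.
    apply: (@connect_trans _ _ y); first by apply: connect1; rewrite /= setU11.
    by apply: connect_sub yc => u u' /= uA; apply: connect1; rewrite /= setU1r.
  apply: pairing_sub prc.
    apply/subsetP => E; rewrite !inE => /andP[EA EF]; rewrite EF orbT andbT negb_or EA andbT.
    by apply: contraNneq xyF => <-.
  apply/subsetP => u; rewrite !inE => /and3P[uc uy]; rewrite (negPf uy) /= uc => uU.
  by rewrite uU orbT andbT; apply: contraNneq xU => <-.
have [ay|ay] := eqVneq a y.
  by subst a; apply: (move_end b) => //; rewrite eq_sym.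
have [bY|bY] := eqVneq b y.
  subst b; apply: (move_end a) => //.
    by rewrite (sym_connect_sym _) // => u u' /=; rewrite setUC.
  by apply: pairing_sub pr => //; apply/subsetP=> u; rewrite !inE => /and3P[-> ->].
move: aU bU; rewrite !inE (negPf ay) (negPf bY) /= => aU bU.
exists A, a, b; rewrite !inE aU bU ab !orbT; split; first by split=> //; apply: subset_trans AF (subsetUr _ _).
apply: (@pairing_sub ([set x; y] |: (F :\: A)) _ (x |: (U :\ a :\ b))).
- apply/subsetP => E; rewrite !inE => /orP[/eqP->|/andP[-> ->]]; last by rewrite orbT.
  by rewrite eqxx andbT; apply: contra xyF => /(subsetP AF).
- apply/subsetP => u; rewrite !inE => /orP[/eqP->|/and3P[-> -> ->]]; last by rewrite orbT.
  by rewrite eqxx andbT; apply/andP; split; apply: contraNneq xU => ->.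
apply: IH; first by rewrite !inE (negPf xU) !andbF.
  by rewrite inE (negPf xyF) andbF.
apply: pairing_sub pr => //; apply/subsetP => u; rewrite !inE => /and3P[-> ->].
by case/orP=> ->; rewrite ?orbT.
Qed.

Variable h : rel T.
Hypotheses (h_sym : symmetric h) (h_irr : irreflexive h).

(** A tree grows here by one leaf at a time, so induction on [grown] amounts to removing a leaf of a
    spanning tree. *)
Inductive grown : {set T} -> Prop :=
| grown1 x : grown [set x]
| grownU S x y : grown S -> y \in S -> x \notin S -> h x y -> grown (x |: S).

(** Quantifying over [U] makes the removal of a leaf [x] with neighbour [y] inductive: a leaf
    outside [U] is dropped, a leaf with [y] in [U] is paired with [y] by their edge, and otherwise
    [y] takes the place of [x] and [pairing_detour] moves the end back. *)
Lemma grown_pairing R : grown R ->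
  forall U, U \subset R -> pairing (edges_in h R) U (#|U|./2).
Proof.
have edges_inS S S' : S \subset S' -> edges_in h S \subset edges_in h S'.
  move=> SS; apply/subsetP => E; rewrite !inE => /andP[-> /=] /subset_trans; exact.
elim=> [x U /subset_leq_card|S x y _ IH yS xS hxy U US].
  by rewrite cards1; case: #|U| => [|[]].
have xyS : [set x; y] \notin edges_in h S by rewrite inE subUset !sub1set (negPf xS) andbF.
have xyS' : [set x; y] \in edges_in h (x |: S).
  by apply/edges_inP; exists x, y; rewrite !inE eqxx yS orbT.
have SxS : edges_in h S \subset edges_in h (x |: S) by apply/edges_inS/subsetUr.
have [xU|xU] := boolP (x \in U); last first.
  apply: pairing_sub SxS (subxx _) (IH _ _); apply/subsetP => u uU.
  by have := subsetP US u uU; rewrite !inE; case: eqP uU xU => // -> ->.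
have US' : U :\ x \subset S by rewrite subDset.
have [yU|yU] := boolP (y \in U :\ x).
  rewrite (cardsD1 x) xU (cardsD1 y) yU /=.
  exists [set [set x; y]], x, y; split.
    rewrite sub1set; split=> //; first by apply: contraNneq xS => ->.
      by move: yU; rewrite inE => /andP[].
    by apply: connect1; rewrite /= inE.
  apply: (@pairing_sub (edges_in h S) _ (U :\ x :\ y)) => //.
    by rewrite subsetD SxS disjoint_sym disjoints1.
  exact/IH/(subset_trans (subsetDl _ _)).
rewrite -(setD1K xU).
have -> : #|x |: U :\ x| = #|y |: U :\ x| by rewrite !cardsU1 yU !inE eqxx.
apply: (@pairing_sub ([set x; y] |: edges_in h S) _ (x |: U :\ x)) => //.
  by rewrite subUset sub1set xyS' SxS.
apply: pairing_detour => //; first by rewrite !inE eqxx.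
by apply: IH; rewrite subUset sub1set yS US'.
Qed.

Lemma component_grown x : grown [set y | connect h x y].
Proof.
set S := [set y | _].
suff main n S' : #|S :\: S'| < n -> grown S' -> x \in S' -> S' \subset S -> grown S.
  by apply: main (ltnSn _) (grown1 x) _ _; rewrite ?inE // sub1set inE connect0.
elim: n S' => // n IH S' Sn gS' xS' SS'.
have [/(conj SS')/andP|] := boolP (S \subset S').
  by rewrite -eqEsubset => /eqP <-.
case/subsetPn => z zS zS'; rewrite inE in zS.
have [a [b [aS' bS' hab]]] := connect_exit zS xS' zS'.
have bS : b \in S.
  have := subsetP SS' a aS'; rewrite !inE => /connect_trans; apply; exact: connect1.
apply: (IH (b |: S')); rewrite ?inE ?xS' ?orbT //.
- rewrite -ltnS; apply: leq_trans Sn; rewrite ltnS; apply: proper_card.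
  apply/properP; split; first by apply: setDS; apply: subsetUr.
  by exists b; rewrite !inE ?eqxx ?bS' //; move: bS; rewrite inE => ->.
- by apply: (grownU gS' aS' bS'); rewrite h_sym.
- by rewrite subUset sub1set bS SS'.
Qed.

End Pairings.

(** * Closing the pairs through the hub *)

Section HubPackings.
Variables (T : finType) (e : rel T) (v : T).
Hypotheses (e_sym : symmetric e) (e_irr : irreflexive e).
Hypothesis hub : forall u, u != v -> e v u.

Definition spokes (U : {set T}) : {set {set T}} := [set [set v; u] | u in U].

(** Each pair is closed to a cycle by the two spokes at its ends; since all ends are distinct, no
    spoke is used twice. *)
Lemma pairing_packs (F : {set {set T}}) (U : {set T}) k :
  F \subset edges_in e (~: [set v]) -> U \subset ~: [set v] -> pairing F U k ->
  packs e (F :|: spokes U) k.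
Proof.
elim: k F U => [|k IH] F U FE UW /=; first by move=> _; apply: packs0.
case=> A [a [b [[AF ab aU bU /connectP[p0 p0A bE]] pr]]].
(* The edge set [A] need not be a path, so a path without repeated vertices is extracted from it. *)
case/shortenP: p0A bE => p pA p_uniq _ bE.
have inA x y : [set x; y] \in A -> [/\ e x y, x != v & y != v].
  move=> /(subsetP AF)/(subsetP FE); rewrite inE subUset !sub1set !inE.
  case/andP=> /edge_setP[x' [y' [exy /setP E]]] /andP[-> ->]; split=> //.
  move: (E x') (E y'); rewrite !inE !eqxx ?orbT /= => /orP[] /eqP Ex /orP[] /eqP Ey;
    subst => //; try by rewrite e_irr in exy.
  by rewrite e_sym.
have av : a != v by have := subsetP UW a aU; rewrite !inE.
have bv : b != v by have := subsetP UW b bU; rewrite !inE.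
pose A' := A :|: [set [set v; a]; [set v; b]].
have vp : v \notin a :: p.
  have pv : all (fun z => z != v) p.
    elim: (p) (a) pA => //= y q IHq x /andP[/inA[_ _ ->] /= yq]; exact: IHq yq.
  by rewrite inE eq_sym negb_or av; apply/negP => /(allP pv); rewrite eqxx.
have p_size : 0 < size p by case: (p) bE ab => //= ->; rewrite eqxx.
have cs : cycle_edges (v :: a :: p) \subset A'.
  apply: cycle_edges_sub; rewrite /= !inE eqxx orbT /= rcons_path -bE /=.
  rewrite !inE [[set b; v]]setUC eqxx !orbT andbT.
  by apply: sub_path pA => x y /=; rewrite inE => ->.
apply: (@packs_cons _ _ _ _ (v :: a :: p)).
- rewrite /is_cycle cons_uniq vp p_uniq /= !ltnS p_size hub // rcons_path -bE [e b v]e_sym hub // andbT.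
  by apply: sub_path pA => x y /inA[].
- apply: subset_trans cs _; apply: setUSS => //.
  by apply/subsetP => E; rewrite !inE => /orP[] /eqP->; apply: imset_f.
apply: packs_sub (IH _ _ _ _ pr) _ (leqnn _).
- exact: subset_trans (subsetDl _ _) FE.
- by apply: subset_trans UW; apply: subset_trans (subsetDl _ _) (subsetDl _ _).
have vE E : E \in F -> v \notin E.
  by move/(subsetP FE); rewrite inE => /andP[_ /subsetP EW]; apply/negP => /EW; rewrite !inE eqxx.
apply: subset_trans (setDS _ cs); apply/subsetP => E; rewrite !inE.
case/orP=> [/andP[EA EF]|/imsetP[u]].
  rewrite EF negb_or EA /= andbT negb_or.
  by apply/andP; split; apply: contraNneq (vE _ EF) => ->; rewrite !inE eqxx.
rewrite !inE => /and3P[ub ua uU] ->; rewrite (imset_f _ uU) orbT andbT.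
rewrite !negb_or; apply/and3P; split.
- by apply/negP => /(subsetP AF)/vE; rewrite !inE eqxx.
- by apply: contraNneq ua => /set2_inj ->.
- by apply: contraNneq ub => /set2_inj ->.
Qed.

(** Components of [h] are peeled off one at a time, each using the spokes of its own vertices. The
    bound [(3 * k).-1] says fewer than [3 * k] edges, but also fits the case of no edges and
    [k = 0]. *)
Lemma triangle_free_packs (h : rel T) (w : T -> T -> T -> bool) (X : {set T}) :
  symmetric h -> subrel h e -> triangle_free h -> side_function e v w ->
  X \subset ~: [set v] -> (forall x y, h x y -> x \in X -> y \in X) ->
  exists2 k, packs e (edges_in h X :|: spokes X) k & #|edges_in h X| <= (3 * k).-1.
Proof.
move=> h_sym he tf sides.
have h_irr : irreflexive h by move=> x; apply/negP => /he; rewrite e_irr.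
have [n] := ubnP #|X|; elim: n X => // n IH X Xn XW Xcl.
have [E0|[E0 /edges_inP[x [y [hxy xX yX _]]]]] := set_0Vmem (edges_in h X).
  by exists 0; [apply: packs0|rewrite E0 cards0].
set S := [set z | connect h x z].
have SX : S \subset X.
  apply/subsetP => z; rewrite inE => xz; apply/negPn/negP => zX.
  by have [a [b [aX bX hab]]] := connect_exit xz xX zX; rewrite (Xcl a b) in bX.
have xS : x \in S by rewrite inE connect0.
have Scl a b : h a b -> a \in S -> b \in S.
  by move=> hab; rewrite !inE => /connect_trans; apply; apply: connect1.
have XScl a b : h a b -> a \in X :\: S -> b \in X :\: S.
  move=> hab; rewrite !inE => /andP[aS aX]; rewrite (Xcl a b) // andbT.
  by apply: contra aS => bS; have := Scl b a; rewrite h_sym !inE bS hab; apply.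
have [||k2 pk2 E2] := IH (X :\: S) _ _ XScl.
- rewrite -ltnS; apply: leq_trans Xn; rewrite ltnS; apply: proper_card.
  by apply/properP; split; [apply: subsetDl|exists x; rewrite // !inE connect0].
- exact: subset_trans (subsetDl _ _) XW.
have SW : S \subset ~: [set v] by apply: subset_trans SX XW.
have S2 : 1 < #|S|.
  apply/card_gt1P; exists x, y; split=> //; first exact: Scl xS.
  by case: eqVneq hxy => // ->; rewrite h_irr.
have vS : v \notin S by apply/negP => /(subsetP SW); rewrite !inE eqxx.
have vX : v \notin X by apply/negP => /(subsetP XW); rewrite !inE eqxx.
have bound := triangle_free_bound h_sym h_irr he tf sides vS S2.
have pr := grown_pairing (component_grown h_sym x) (subxx _).
have EW : edges_in h S \subset edges_in e (~: [set v]).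
  apply/subsetP => E /edges_inP[a [b [hab aS bS ->]]]; apply/edges_inP; exists a, b.
  by rewrite he // !(subsetP SW).
have pk1 := pairing_packs EW SW pr.
exists (#|S|./2 + k2).
  apply: packs_sub (packs_cat pk1 pk2 _) _ (leqnn _).
    rewrite -setI_eq0; apply/eqP/setP => E; rewrite !in_setI !in_setU in_set0; apply/negP => /andP[].
    case/orP=> [/edges_inP[a [b [hab aS bS ->]]]|/imsetP[u uS ->]].
      case/orP=> [/edges_inP[a' [b' [hab' aS' bS' E1]]]|/imsetP[u _ E1]].
        move: aS' bS'; have := set21 a b; rewrite E1 in_set2 => /orP[] /eqP<-; by rewrite !in_setD aS.
      by have := set21 v u; rewrite -E1 in_set2 => /orP[] /eqP Ev; move: vS; rewrite Ev ?aS ?bS.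
    case/orP=> [/edges_inP[a' [b' [hab' aS' bS' E1]]]|/imsetP[u' uS' E1]].
      have := set21 v u; rewrite E1 in_set2 => /orP[] /eqP Ev.
        by move: aS'; rewrite -Ev in_setD (negPf vX) andbF.
      by move: bS'; rewrite -Ev in_setD (negPf vX) andbF.
    by move: uS'; rewrite -(set2_inj E1) in_setD uS.
  rewrite !subUset; apply/and3P; split; [apply/andP; split|..].
  - apply/subsetP => E /edges_inP[a [b [hab aS bS ->]]]; rewrite inE; apply/orP; left.
    by apply/edges_inP; exists a, b; rewrite !(subsetP SX).
  - apply/subsetP => E /imsetP[u uS ->]; by rewrite inE (imset_f _ (subsetP SX u uS)) orbT.
  - apply/subsetP => E /edges_inP[a [b [hab + + ->]]]; rewrite 2!in_setD => /andP[_ aX] /andP[_ bX].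
    by rewrite inE; apply/orP; left; apply/edges_inP; exists a, b.
  - apply/subsetP => E /imsetP[u]; rewrite in_setD => /andP[_ uX] ->.
    by rewrite inE (imset_f _ uX) orbT.
have : #|edges_in h X| <= #|edges_in h S| + #|edges_in h (X :\: S)|.
  apply: leq_trans (leq_card_setU _ _); apply/subset_leq_card/subsetP => E.
  case/edges_inP=> a [b [hab aX bX ->]]; rewrite inE; apply/orP.
  have [aS|aS] := boolP (a \in S); [left|right]; apply/edges_inP; exists a, b; split=> //.
  - exact: Scl aS.
  - by rewrite inE aS.
  - by apply: (XScl a) => //; rewrite inE aS.
(* With m half of |S| rounded down, [bound] allows at most 3m - 1 edges in [S] for either parity of
   |S|; the rest has at most [3 * k2]. *)
move: E2 bound S2; card_lia.
Qed.
End HubPackings.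

(** * Edge-disjoint triangles *)

Lemma next_mid (T : eqType) (x u : T) p1 p2 : uniq (x :: p1 ++ u :: p2) ->
  next (x :: p1 ++ u :: p2) u = head x p2.
Proof.
move=> Up; rewrite -(next_rot (size (x :: p1)) Up) -cat_cons rot_size_cat.
by case: p2 {Up} => [|y p2] /=; rewrite eqxx.
Qed.

Section Triangles.
Variables (T : finType) (e : rel T).
Hypothesis e_sym : symmetric e.
Implicit Types (t : {set T}) (P : {set {set T}}).

Definition pairs t : {set {set T}} := [set E : {set T} | E \subset t & #|E| == 2].

Definition triangle t := (#|t| == 3) && [forall x in t, forall y in t, (x != y) ==> e x y].

Lemma triangleP t :
  reflect (#|t| = 3 /\ forall x y, x \in t -> y \in t -> x != y -> e x y) (triangle t).
Proof.
apply: (iffP andP) => [[/eqP t3 /forall_inP adj]|[t3 adj]]; split=> //; last 1 first.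
- by apply/forall_inP => x xt; apply/forall_inP => y yt; apply/implyP; apply: adj.
- by move=> x y xt yt xy; apply: (implyP (forall_inP (adj x xt) y yt)).
- exact/eqP.
Qed.

(** Distinct members share at most one vertex, so the triangles are edge-disjoint. *)
Definition linear_family P : Prop :=
  (forall t, t \in P -> triangle t) /\
  (forall t t' x y, t \in P -> t' \in P -> x != y ->
     x \in t -> y \in t -> x \in t' -> y \in t' -> t = t').

Lemma pairsP t E :
  reflect (exists x y, [/\ x != y, x \in t, y \in t & E = [set x; y]]) (E \in pairs t).
Proof.
rewrite inE; apply: (iffP andP) => [[Et /cards2P[x [y [xy Exy]]]]|[x [y [xy xt yt ->]]]].
  by move: Et; rewrite Exy subUset !sub1set => /andP[xt yt]; exists x, y.
by rewrite subUset !sub1set xt yt cards2 xy.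
Qed.

Lemma linear_pairs_disjoint P t t' : linear_family P -> t \in P -> t' \in P -> t != t' ->
  [disjoint pairs t & pairs t'].
Proof.
move=> [_ lin] tP tP' tt; rewrite -setI_eq0; apply: contraNT tt => /set0Pn[E].
rewrite in_setI => /andP[/pairsP[x [y [xy xt yt ->]]]]; rewrite inE subUset !sub1set.
by case/andP=> /andP[xt' yt'] _; rewrite (lin t t' x y).
Qed.

Lemma triangle_cycle t : triangle t -> is_cycle e (enum t) /\ cycle_edges (enum t) \subset pairs t.
Proof.
case/triangleP; rewrite cardE => t3 adj.
have := enum_uniq t; have : {subset enum t <= t} by move=> x; rewrite mem_enum.
rewrite /is_cycle t3; case: (enum t) t3 => [|a [|b [|c []]]] //= _ sub abc.
have [at_ bt ct] : [/\ a \in t, b \in t & c \in t] by rewrite !sub ?inE ?eqxx ?orbT.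
move: (abc); rewrite !inE negb_or andbT => /andP[/andP[ab ac] bc].
split; first by rewrite ?inE ?negb_or ?ab ?ac ?bc !adj // eq_sym.
apply: cycle_edges_sub; rewrite /= andbT; apply/and3P; split; apply/pairsP.
- by exists a, b.
- by exists b, c.
- by exists c, a; rewrite eq_sym.
Qed.

Lemma linear_packs P : linear_family P -> packs e (\bigcup_(t in P) pairs t) #|P|.
Proof.
move=> lin; have [tri _] := lin.
exists [seq enum (t : {set T}) | t <- enum P]; split.
- by rewrite size_map -cardE.
- by rewrite all_map; apply/allP => t; rewrite mem_enum => /tri/triangle_cycle[].
- rewrite all_map; apply/allP => t; rewrite mem_enum => tP.
  by apply: subset_trans (proj2 (triangle_cycle (tri t tP))) _; apply: bigcup_sup.
have : {subset enum P <= P} by move=> t; rewrite mem_enum.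
rewrite pairwise_map; elim: (enum P) (enum_uniq P) => //= t s IH /andP[ts us] sub.
rewrite IH // ?andbT; last by move=> t' ts'; apply: sub; rewrite inE ts' orbT.
apply/allP => t' ts'; have tP := sub t (mem_head t s).
have tP' : t' \in P by apply: sub; rewrite inE ts' orbT.
apply: disjointW (linear_pairs_disjoint lin tP tP' _).
- exact: (proj2 (triangle_cycle (tri t tP))).
- exact: (proj2 (triangle_cycle (tri t' tP'))).
- by apply: contraNneq ts => ->.
Qed.

Definition covered P : rel T := [rel x y | (x != y) && [exists t in P, (x \in t) && (y \in t)]].

(** The third vertex of the member of [P] through [x] and [y], and the junk value
    [x] if [x] and [y] are not covered. *)
Definition third P (x y : T) : T := odflt x [pick z | [&& z != x, z != y & [set x; y; z] \in P]].

Lemma in_set3 (a b c x : T) : (x \in [set a; b; c]) = [|| x == a, x == b | x == c].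
Proof. by rewrite !inE orbA. Qed.

Lemma thirdP P x y : linear_family P -> covered P x y ->
  [/\ third P x y != x, third P x y != y & [set x; y; third P x y] \in P].
Proof.
move=> [tri _] /andP[xy /exists_inP[t tP /andP[xt yt]]].
have [t3 _] := triangleP _ (tri t tP).
rewrite /third; case: pickP => [z /and3P[] //|none].
move: t3; rewrite (cardsD1 x) xt (cardsD1 y) !inE eq_sym xy yt !add1n => -[/eqP/cards1P[z tz]].
have /setP tE := tz.
have := tE z; rewrite !inE eqxx => /and3P[zy zx zt].
have := none z; rewrite zx zy /=.
suff -> : [set x; y; z] = t by rewrite tP.
apply/setP => u; rewrite in_set3; have := tE u; rewrite !inE.
have [->|ux] := eqVneq u x; first by rewrite xt.
by have [->|uy] := eqVneq u y; first by rewrite yt.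
Qed.

Definition all_cycles_in P : Prop :=
  forall c, uniq c -> 2 < size c -> cycle (covered P) c -> [set x in c] \in P.

(** * Shortest bad cycles *)

Section BadCycle.
Variable P : {set {set T}}.
Hypothesis (lin : linear_family P).

Definition bad c := [&& uniq c, 2 < size c, cycle (covered P) c & [set x in c] \notin P].

Definition min_bad c := bad c /\ forall c', bad c' -> size c <= size c'.

Lemma min_bad_rot i c : min_bad c -> min_bad (rot i c).
Proof.
case=> bc mc; split; last by rewrite size_rot.
rewrite /bad rot_uniq size_rot rot_cycle.
by have -> : [set x in rot i c] = [set x in c]; first by apply/setP => x; rewrite !inE mem_rot.
Qed.

Lemma min_bad_exists : ~ all_cycles_in P -> exists c, min_bad c.
Proof.
move=> nall; have [c bc] : exists c, bad c.
  apply: NNPP => nb; apply: nall => c uc sc cc; apply/negPn/negP => cP.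
  by apply: nb; exists c; rewrite /bad uc sc cc cP.
have [n] := ubnP (size c); elim: n c bc => // n IH c bc cn.
have [[c' [bc' sc']]|no] := classic (exists c', bad c' /\ size c' < size c).
  by apply: (IH c' bc'); rewrite -ltnS; apply: leq_trans cn.
by exists c; split=> // c' bc'; rewrite leqNgt; apply/negP => lt; apply: no; exists c'.
Qed.

Lemma covered_sym : symmetric (covered P).
Proof.
move=> x y; rewrite /covered /= eq_sym; congr (_ && _).
by apply: eq_existsb => t; rewrite [(x \in t) && _]andbC.
Qed.

Lemma covered_in t x y : t \in P -> x \in t -> y \in t -> x != y -> covered P x y.
Proof. by move=> tP xt yt xy; rewrite /covered /= xy; apply/exists_inP; exists t; rewrite ?xt. Qed.

(** The vertex set of a cycle shorter than the minimal bad one is a member of [P], and sharing two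
    vertices with [t] it is [t] by linearity. Contradictions will come from a vertex [u] that lies
    in only one of them. *)
Lemma short_cycle c c' t x y u : min_bad c -> size c' < size c -> uniq c' -> 2 < size c' ->
  cycle (covered P) c' -> t \in P -> x != y -> x \in t -> y \in t -> x \in c' -> y \in c' ->
  (u \in c') = (u \in t).
Proof.
move=> [_ mc] lt uc' sc' cc' tP xy xt yt xc yc.
have [cP|cP] := boolP ([set z in c'] \in P); last first.
  by have := mc c'; rewrite /bad uc' sc' cc' cP => /(_ isT); rewrite leqNgt lt.
have -> : t = [set z in c'] by apply: (proj2 lin _ _ x y); rewrite ?inE.
by rewrite inE.
Qed.

(** If the third vertex [z] were on the cycle, a chord from [z] to [x'] or [x] would cut off a
    shorter cycle with just two vertices of the triangle, unless the whole cycle is the triangle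
    itself. *)
Lemma third_notin x x' s : min_bad [:: x, x' & s] -> third P x x' \notin [:: x, x' & s].
Proof.
move=> mb; have [bc _] := mb; have /and4P[uc sc cc cP] := bc.
have rxx : covered P x x' by case/andP: cc.
have [zx zx' tP] := thirdP lin rxx; set z := third P x x' in zx zx' tP *.
rewrite !inE (negPf zx) (negPf zx') /=; apply/negP => zs.
case/splitPr: zs mb bc uc sc cc cP => s1 s2 mb bc uc sc cc cP.
have xt : x \in [set x; x'; z] by rewrite in_set3 eqxx.
have xt' : x' \in [set x; x'; z] by rewrite in_set3 eqxx orbT.
have zt : z \in [set x; x'; z] by rewrite in_set3 eqxx !orbT.
move: (cc); rewrite /= rcons_cat /= cat_path /= => /andP[_ /and3P[p1 p1z p2]].
move: (uc); rewrite /= !inE !mem_cat !inE !negb_or cat_uniq /=.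
move=> /and3P[/and3P[xx' xs1 /andP[xz xs2]] /and3P[xs1' xz' xs2']].
move=> /and4P[us1 /norP[zs1 dis] zs2 us2].
have [s1E|s1N] := eqVneq s1 [::]; last first.
  (* The stretch from [x'] to [z], closed by the chord [z x'], misses [x]. *)
  have : (x \in x' :: rcons s1 z) = (x \in [set x; x'; z]).
    apply: (short_cycle _ mb _ _ _ _ tP _ xt' zt).
    - by rewrite /= size_rcons size_cat /= addnS !ltnS leq_addr.
    - by rewrite /= mem_rcons inE negb_or xz' xs1' rcons_uniq zs1 us1.
    - by rewrite /= size_rcons; case: (s1) s1N.
    - by rewrite /= !rcons_path p1 p1z last_rcons (covered_in tP zt xt' zx').
    - by rewrite eq_sym.
    - exact: mem_head.
    - by rewrite inE mem_rcons mem_head orbT.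
  by rewrite xt !inE mem_rcons inE (negPf xx') (negPf xz) (negPf xs1).
subst s1; have [s2E|s2N] := eqVneq s2 [::].
  move: cP; rewrite s2E; suff -> : [set y in [:: x; x'; z]] = [set x; x'; z] by rewrite tP.
  by apply/setP => y; rewrite in_set3 !inE.
(* The cycle [x], [z], [s2] uses the chord [x z] and misses [x']. *)
have : (x' \in [:: x, z & s2]) = (x' \in [set x; x'; z]).
  apply: (short_cycle _ mb _ _ _ _ tP _ xt zt).
  - by [].
  - by rewrite /= inE negb_or xz xs2 zs2 us2.
  - by case: (s2) s2N.
  - by rewrite /= p2 (covered_in tP) // eq_sym.
  - by [].
  - exact: mem_head.
  - by rewrite !inE eqxx orbT.
by rewrite xt' !inE eq_sym (negPf xx') (negPf xz') (negPf xs2').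
Qed.
(** Let edges [x x'] and [u u'] of the cycle have the same third vertex [z]. If they are adjacent,
    linearity identifies their triangles; otherwise the stretch from [x'] to [u] closed through [z]
    is shorter, since [z] replaces both [x] and [u']. *)
Lemma third_inj c x u : min_bad c -> x \in c -> u \in c ->
  third P x (next c x) = third P u (next c u) -> x = u.
Proof.
move=> mb xc uc zE; apply/eqP/negPn/negP => xu.
have /and4P[c_uniq _ _ _] := proj1 mb.
have [i c' cE] := rot_to xc.
have nextE y : next c y = next (x :: c') y by rewrite -cE next_rot.
move/(min_bad_rot i): (mb); rewrite cE => {}mb.
move: zE uc; rewrite !nextE -(mem_rot i) cE => {c xc c_uniq i cE nextE} zE uc.
have [bc _] := mb; have /and4P[c_uniq sc cc _] := bc.
case: c' => [|x' s] in zE uc mb bc c_uniq sc cc *; first by [].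
have nx : next [:: x, x' & s] x = x' by rewrite /= eqxx.
have [zx zx' tP] := thirdP lin (proj1 (andP cc)).
have zc := third_notin mb; rewrite nx in zE.
set z := third P x x' in zE zx zx' tP zc.
have xt : x \in [set x; x'; z] by rewrite in_set3 eqxx.
have xt' : x' \in [set x; x'; z] by rewrite in_set3 eqxx orbT.
have zt : z \in [set x; x'; z] by rewrite in_set3 eqxx !orbT.
have {}uc : u \in x' :: s by move: uc; rewrite inE eq_sym (negPf xu).
have ru : covered P u (next [:: x, x' & s] u) by apply: next_cycle => //; rewrite inE uc orbT.
have [_ _ tP'] := thirdP lin ru; rewrite -zE in tP'.
have zu : z != u by apply: contraNneq zc => ->; rewrite inE uc orbT.
have ut : u \in [set x; x'; z] -> u = x'.
  by rewrite in_set3 [u == x]eq_sym (negPf xu) [u == z]eq_sym (negPf zu) orbF => /eqP.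
have [s0 [s2 sE]] : exists s0 s2, x' :: s = s0 ++ u :: s2.
  by case/splitPr: uc => s0 s2; exists s0, s2.
have nu : next [:: x, x' & s] u = head x s2 by rewrite sE; apply: next_mid; rewrite -sE.
rewrite nu in tP' ru.
have same a : a != z -> a \in [set u; head x s2; z] -> a \in [set x; x'; z] ->
    [set u; head x s2; z] = [set x; x'; z].
  by move=> az at' at_; apply: (proj2 lin _ _ a z) => //; rewrite in_set3 eqxx !orbT.
have uE : u \in [set u; head x s2; z] by rewrite in_set3 eqxx.
(* Three positions are possible: [u] is [x'], the successor of [u] wraps around to [x], or the two
   edges are disjoint. *)
case: s0 => [|y0 s1] in sE.
  case: sE => ? ?; subst u s2.
  have nE : head x s \in [set x'; head x s; z] by rewrite in_set3 eqxx orbT.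
  move: nE; rewrite (same x') // 1?eq_sym //; case: (s) c_uniq zc sc => //= u' s3.
  rewrite in_set3 !inE !negb_or => /and3P[/and3P[_ xu' _] /andP[xu'' _] _] /and4P[_ _ zu' _] _.
  by rewrite ![u' == _]eq_sym (negPf xu') (negPf xu'') (negPf zu').
case: sE => ? sE; subst y0.
have ux' : u != x'.
  by move: c_uniq; rewrite sE /= mem_cat inE !negb_or => /and3P[_ /and3P[_ + _] _]; rewrite eq_sym.
case: s2 => [|u' s3] in sE nu tP' ru same uE.
  have E : [set u; x; z] = [set x; x'; z].
    by apply: (same x) => //; rewrite ?in_set3 ?eqxx ?orbT // eq_sym.
  by move: uE; rewrite /= E => /ut/eqP; rewrite (negPf ux').
move: cc; rewrite sE /= rcons_cat /= cat_path /= => /andP[_ /and3P[p1 p1u _]].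
move: c_uniq; rewrite sE /= cat_uniq mem_cat /= !inE.
move=> /and3P[_ /norP[x's1 _] /and4P[us1 /norP[u_s1 _] _ _]].
move: zc; rewrite sE !inE mem_cat !inE => /norP[_ /norP[_ /norP[zs1 _]]].
suff E : (u \in [:: z, x' & rcons s1 u]) = (u \in [set x; x'; z]).
  have /ut/eqP : u \in [set x; x'; z] by rewrite -E !inE mem_rcons mem_head !orbT.
  by rewrite (negPf ux').
apply: (short_cycle _ mb _ _ _ _ tP _ xt' zt).
- by rewrite sE /= size_rcons size_cat /= !addnS !ltnS leq_addr.
- by rewrite /= inE !mem_rcons !inE !negb_or rcons_uniq zx' zu zs1 eq_sym ux' x's1 u_s1 us1.
- by rewrite /= size_rcons.
- rewrite /= !rcons_path last_rcons p1 p1u (covered_in tP) //=.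
  by apply: (covered_in tP') => //; rewrite ?in_set3 ?eqxx ?orbT // eq_sym.
- by rewrite eq_sym.
- by rewrite !inE eqxx orbT.
- exact: mem_head.
Qed.

End BadCycle.

Lemma covered_rel P x y : linear_family P -> covered P x y -> e x y.
Proof.
move=> [tri _] /andP[xy /exists_inP[t tP /andP[xt yt]]].
by have [_ adj] := triangleP _ (tri t tP); apply: adj.
Qed.

Lemma cycle_edges_next (c : seq T) E : uniq c -> E \in cycle_edges c ->
  exists2 x, x \in c & E = [set x; next c x].
Proof.
move=> c_uniq; suff sub : cycle_edges c \subset [set [set x; next c x] | x in c].
  by move/(subsetP sub)/imsetP.
apply: cycle_edges_sub; have := cycle_next c_uniq.
apply: sub_in_cycle (allss c) => x y xc yc /= /eqP <-; exact: imset_f.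
Qed.

(** Two new triangles meet only in [v], because the third vertices are distinct and off the cycle. A
    new triangle and a kept one share at most one vertex, because the part of [s x] away from [v]
    lies in the discarded [t x]. So the exchanged family [R] is linear, has the size of [P], and
    frees the edges of [c]. *)
Lemma not_all_cycles_packs P v : linear_family P -> (forall t, t \in P -> v \notin t) ->
  (forall u, u != v -> e v u) -> ~ all_cycles_in P -> exists F, packs e F #|P|.+1.
Proof.
move=> lin vP hub /min_bad_exists[c mb].
have [/and4P[c_uniq sc cc _] _] := mb.
pose y x := third P x (next c x).
pose t x := [set x; next c x; y x].
have rel_next x : x \in c -> covered P x (next c x) by move=> xc; apply: next_cycle.
have yP x : x \in c -> [/\ y x != x, y x != next c x & t x \in P].
  by move=> xc; apply: thirdP lin (rel_next x xc).
have yc x : x \in c -> y x \notin c.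
  move=> xc; have [i s cE] := rot_to xc.
  have := min_bad_rot i mb; rewrite /y -(next_rot i c_uniq) -(mem_rot i) cE.
  case: s {cE} => [|x' s] mb'; first by have [/and4P[]] := mb'.
  by have := third_notin lin mb'; rewrite /= eqxx.
have y_inj x u : x \in c -> u \in c -> y x = y u -> x = u by apply: third_inj.
have t_inj : {in c &, injective t}.
  move=> x u xc uc tE; apply: y_inj => //.
  have : y x \in t u by rewrite -tE in_set3 eqxx !orbT.
  rewrite in_set3 => /or3P[] /eqP // yE; have := yc x xc; rewrite yE ?uc //.
  by rewrite mem_next uc.
pose Q := [set t x | x in c].
have QP : Q \subset P by apply/subsetP => _ /imsetP[x xc ->]; have [] := yP x xc.
have vt x : x \in c -> v \notin t x by move=> xc; apply: vP; have [] := yP x xc.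
have xv x : x \in c -> x != v.
  by move/vt; rewrite in_set3 negb_or eq_sym => /andP[].
have yv x : x \in c -> y x != v.
  by move/vt; rewrite in_set3 !negb_or [v == y x]eq_sym => /and3P[].
pose s x := [set v; x; y x].
have s_t x a : x \in c -> a \in s x -> a != v -> a \in t x.
  by move=> xc; rewrite !in_set3 => /or3P[->|->|->]; rewrite ?orbT.
have s_s x u a : x \in c -> u \in c -> a \in s x -> a \in s u -> a != v -> x = u.
  move=> xc uc; rewrite !in_set3; case: (a == v) => //= /orP[] /eqP -> /orP[] /eqP E _ //.
  - by move: (yc u uc); rewrite -E xc.
  - by move: (yc x xc); rewrite E uc.
  - exact: y_inj.
have s_inj : {in c &, injective s}.
  move=> x u xc uc sE; apply: (s_s x u x) => //; rewrite -?sE ?in_set3 ?eqxx ?orbT //.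
  exact: xv.
pose R := [set s x | x in c] :|: (P :\: Q).
have PQ_s x t' a b : x \in c -> t' \in P :\: Q -> a != b -> a \in s x -> b \in s x ->
    a \in t' -> b \in t' -> False.
  move=> xc; rewrite in_setD => /andP[t'Q t'P] ab as_ bs at_ bt; move/negP: t'Q; apply.
  have av : a != v by apply: contraNneq (vP _ t'P) => <-.
  have bv : b != v by apply: contraNneq (vP _ t'P) => <-.
  have [_ _ txP] := yP x xc.
  by rewrite (proj2 lin t' (t x) a b) ?s_t //; apply: imset_f.
have linR : linear_family R.
  split=> [t'|t' t'' a b].
    rewrite in_setU in_setD => /orP[/imsetP[x xc ->]|/andP[_ /(proj1 lin)//]].
    have [yx _ tP] := yP x xc.
    have exy : e x (y x).
      by apply: covered_rel lin (covered_in tP _ _ _); rewrite ?in_set3 ?eqxx ?orbT // eq_sym.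
    apply/triangleP; split.
      rewrite /s -setUA cardsU1 cards2 !inE [x == _]eq_sym yx.
      by rewrite [v == x]eq_sym [v == y x]eq_sym (negPf (xv x xc)) (negPf (yv x xc)).
    move=> a b; rewrite !in_set3 => /or3P[] /eqP -> /or3P[] /eqP ->; rewrite ?eqxx // => _.
    - exact/hub/xv.
    - exact/hub/yv.
    - rewrite e_sym; exact/hub/xv.
    - rewrite e_sym; exact/hub/yv.
    - by rewrite e_sym.
  rewrite !(in_setU t') !(in_setU t'').
  move=> /orP[/imsetP[x xc ->]|t'D] /orP[/imsetP[u uc ->]|t''D] ab at_ bt at' bt'.
  - have [av|av] := eqVneq a v; last by rewrite (s_s x u a).
    by rewrite (s_s x u b) //; rewrite eq_sym -av.
  - by case: (PQ_s x t'' a b).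
  - by case: (PQ_s u t' a b).
  - move: t'D t''D; rewrite !in_setD => /andP[_ t'P] /andP[_ t''P].
    exact: (proj2 lin _ _ a b).
have cardR : #|R| = #|P|.
  rewrite cardsU (_ : _ :&: _ = set0) ?cards0 ?subn0; last first.
    apply/setP => t'; rewrite in_setI in_setD in_set0.
    case: imsetP => //= -[x xc ->]; apply/negP => /andP[_ /vP].
    by rewrite in_set3 eqxx.
  rewrite !card_in_imset // -(card_in_imset t_inj) -/Q cardsD (setIidPr QP) subnKC //.
  exact: subset_leq_card.
exists (cycle_edges c :|: \bigcup_(t' in R) pairs t'); rewrite -cardR -add1n.
apply: packs_cat (linear_packs linR) _.
  exists [:: c]; rewrite /= subxx !andbT; split=> //; rewrite /is_cycle c_uniq sc /=.
  by apply: sub_cycle cc => a b; apply: covered_rel.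
rewrite -setI_eq0; apply/eqP/setP => E; rewrite in_set0 in_setI; apply/negP => /andP[].
case/(cycle_edges_next c_uniq) => x xc -> /bigcupP[t' t'R].
rewrite inE subUset !sub1set => /andP[/andP[xt nt] _].
have xn : x != next c x by have /andP[] := rel_next x xc.
have nc : next c x \in c by rewrite mem_next.
move: t'R; rewrite in_setU => /orP[/imsetP[u uc t'E]|].
  have s_c a : a \in c -> a \in s u -> a = u.
    move=> ac; rewrite in_set3 (negPf (xv a ac)) /= => /orP[] /eqP // aE.
    by move: (yc u uc); rewrite -aE ac.
  rewrite t'E in xt nt; move: xn; rewrite (s_c _ nc nt) -{}(s_c x xc xt).
  by rewrite eqxx.
rewrite in_setD => /andP[/negP t'Q t'P]; apply: t'Q.
have [_ _ txP] := yP x xc.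
rewrite (proj2 lin t' (t x) x (next c x)) ?in_set3 ?eqxx ?orbT //; exact: imset_f.
Qed.
End Triangles.

(** * Blocks *)

Lemma exists_maximal (X : finType) (Q : {set X} -> Prop) (A : {set X}) : Q A ->
  exists B : {set X}, [/\ A \subset B, Q B & forall B' : {set X}, B \subset B' -> Q B' -> B' = B].
Proof.
have [n] := ubnP #|~: A|; elim: n A => // n IH A An QA.
have [[B [AB QB]]|no] := classic (exists B : {set X}, A \proper B /\ Q B).
  have [|D [BD QD maxD]] := IH B _ QB.
    rewrite -ltnS; apply: leq_trans An; rewrite ltnS; apply: proper_card.
    by rewrite properC.
  by exists D; split=> //; apply: subset_trans (proper_sub AB) BD.
exists A; split=> // B AB QB; apply/eqP/negPn/negP => BA; apply: no; exists B.
by rewrite properEneq eq_sym BA AB.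
Qed.

Section Blocks.
Variables (T : finType) (e : rel T).
Hypothesis e_sym : symmetric e.
Implicit Types (S C W t : {set T}) (P : {set {set T}}).

Lemma grel_on_sym S : symmetric (grel_on e S).
Proof. by move=> x y; rewrite /grel_on /= e_sym andbCA. Qed.

Lemma star_connected S x : x \in S -> (forall a, a \in S -> a != x -> e x a) -> connected_on e S.
Proof.
move=> xS adj; have toP a : a \in S -> connect (grel_on e S) x a.
  move=> aS; have [->|ax] := eqVneq a x; first exact: connect0.
  by apply: connect1; rewrite /grel_on /= xS aS adj.
move=> a b aS bS; apply: connect_trans (toP b bS).
rewrite (sym_connect_sym (@grel_on_sym S)); exact: toP.
Qed.

Lemma clique_connected S : (forall x y, x \in S -> y \in S -> x != y -> e x y) -> connected_on e S.
Proof.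
move=> adj a b aS bS; apply: (star_connected aS) => // c cS; rewrite eq_sym; exact: adj.
Qed.

Lemma clique_no_cut S : (forall x y, x \in S -> y \in S -> x != y -> e x y) -> no_cut_vertex_on e S.
Proof.
move=> adj x xS; apply: clique_connected => a b; rewrite !in_setD1 => /andP[_ aS] /andP[_ bS].
exact: adj.
Qed.

Lemma component_closed W x a b :
  a \in component_on e W x -> b \in W -> e a b -> b \in component_on e W x.
Proof.
rewrite !inE => /andP[aW xa] bW eab; rewrite bW; apply: connect_trans xa _.
by apply: connect1; rewrite /grel_on /= aW bW eab.
Qed.

Lemma component_connected W x : x \in W -> connected_on e (component_on e W x).
Proof.
move=> xW; set C := component_on e W x.
have xC : x \in C by rewrite inE xW connect0.
suff toP a : a \in C -> connect (grel_on e C) x a.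
  move=> a b aC bC; apply: connect_trans (toP b bC).
  by rewrite (sym_connect_sym (@grel_on_sym C)) toP.
rewrite inE => /andP[_ /connectP[p pW ->]].
elim: p (x) xC pW => [|z p IH] y yC //=.
case/andP=> /and3P[_ zW eyz] pW; have zC := component_closed yC zW eyz.
by apply: connect_trans (IH z zC pW); apply: connect1; rewrite /grel_on /= yC zC eyz.
Qed.

Lemma clique_extend_block C S S' : block_on e C S -> S \subset S' -> S' \subset C ->
  (forall x y, x \in S' -> y \in S' -> x != y -> e x y) -> S' = S.
Proof.
move=> [_ _ _ _ maxS] SS' S'C adj; apply: maxS => //; first exact: clique_connected.
exact: clique_no_cut.
Qed.

Lemma set2_clique a b : e a b ->
  forall x y, x \in [set a; b] -> y \in [set a; b] -> x != y -> e x y.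
Proof.
move=> eab x y; rewrite !inE => /orP[] /eqP -> /orP[] /eqP ->; rewrite ?eqxx // => _.
by rewrite e_sym.
Qed.

(** An edge [x x'] of a block lies in a member [t]. If the block left [t], it would do so along an
    edge [b w] reachable without [x]; a path from [w] to [x] avoiding [b], closed by the edge [x b],
    is then a cycle through two vertices of [t] that is not [t]. So the block lies in the clique [t]
    and equals it by maximality. *)
Lemma cycles_blocks P W : linear_family e P -> all_cycles_in P ->
  (forall t, t \in P -> t \subset W) ->
  (forall x y, x \in W -> y \in W -> e x y -> covered P x y) ->
  nontrivial_components_cactus e W.
Proof.
move=> lin cyc PW cov x0 x0W [y0 [z0 /and3P[y0C z0C eyz0]]].
set C := component_on e W x0 in y0C z0C *.
have Cconn : connected_on e C by apply: component_connected.
have CW : C \subset W by apply/subsetP => a; rewrite inE => /andP[].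
split=> // S blk; have [SC S0 Sconn Scut maxS] := blk.
have SW := subset_trans SC CW.
have [x xS] := set0Pn _ S0; have xC := subsetP SC x xS.
have neighbour U a b : connected_on e U -> a \in U -> b \in U -> a != b ->
    exists2 c, c \in U & e a c.
  move=> Uc aU bU ab; have aa : a \in [set a] by rewrite inE.
  have bb : b \notin [set a] by rewrite inE eq_sym.
  have [c [d [/set1P -> _ /and3P[_ dU ead]]]] := connect_exit (Uc a b aU bU) aa bb.
  by exists d.
(* A one-vertex block is impossible: the component has an edge at [x], which would extend it. *)
have [x' x'S exx'] : exists2 x', x' \in S & e x x'.
  have [y yS|S1] := pickP [pred y in S | y != x].
    by case/andP: yS => yS yx; apply: (neighbour S x y) => //; rewrite eq_sym.
  have SE : S = [set x].
    apply/setP => y; rewrite inE; have := S1 y; rewrite /=; case: (eqVneq y x) => [-> _|_].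
      by rewrite xS.
    by rewrite andbT.
  have [z zC exz] : exists2 z, z \in C & e x z.
    have [<-|xy] := eqVneq y0 x; first by exists z0.
    by apply: (neighbour C x y0) => //; rewrite eq_sym.
  have E := clique_extend_block (S' := [set x; z]) blk _ _ (set2_clique exz).
  exists z => //; rewrite -E ?inE ?eqxx ?orbT //; first by rewrite SE sub1set !inE eqxx.
  by rewrite subUset !sub1set xC zC.
have /andP[xx' /exists_inP[t tP /andP[xt x't]]] := cov x x' (subsetP SW x xS) (subsetP SW x' x'S) exx'.
have [t3 adj] := triangleP e t (proj1 lin t tP).
suff St : S \subset t.
  suff tC : t \subset C by rewrite -(clique_extend_block blk St tC adj).
  apply/subsetP => a at_; have [->//|ax] := eqVneq a x.
  apply: (component_closed xC); first exact: (subsetP (PW t tP)).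
  by apply: adj => //; rewrite eq_sym.
apply/subsetP => u uS; apply/negPn/negP => ut.
have xu : u != x by apply: contraNneq ut => ->.
have c1 : connect (grel_on e (S :\ x)) x' u.
  by apply: (Scut x xS); rewrite in_setD1 ?xu ?x'S // eq_sym xx'.
have [b [w [bt wt]]] := connect_exit c1 x't ut.
case/and3P; rewrite !in_setD1 => /andP[bx bS] /andP[wx wS] ebw.
have wb : w != b by apply: contraNneq wt => ->.
have c2 : connect (grel_on e (S :\ b)) w x.
  by apply: (Scut b bS); rewrite in_setD1 ?wb ?xS // eq_sym bx.
have [p0 p0P xE] := connectP c2.
case/shortenP: p0P xE => p pP p_uniq _ xE {p0}.
have pS : all (mem (S :\ b)) p.
  by elim: (p) (w) pP => //= z q IHq y /andP[/and3P[_ -> _] /=]; apply: IHq.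
have covS a a' : a \in S -> a' \in S -> e a a' -> covered P a a'.
  by move=> aS a'S; apply: cov; apply: (subsetP SW).
have cP : [set z in [:: b, w & p]] \in P.
  apply: cyc.
  - rewrite cons_uniq p_uniq andbT inE eq_sym negb_or wb.
    by apply/negP => /(allP pS); rewrite /= in_setD1 eqxx.
  - by case: (p) xE wx => //= ->; rewrite eqxx.
  - rewrite /cycle rcons_path [last _ _]/= -xE (covered_in tP xt bt) 1?eq_sym // andbT.
    rewrite [path _ _ _]/= covS //=; apply: sub_path pP => a a' /and3P[].
    by rewrite !in_setD1 => /andP[_ aS] /andP[_ a'S]; apply: covS.
move/negP: wt; apply; rewrite (proj2 lin t _ x b tP cP) // 1?eq_sym //.
- by rewrite !inE eqxx orbT.
- by rewrite inE {1}xE in_cons mem_last orbT.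
- by rewrite !inE eqxx.
Qed.

Definition triangles_on W : {set {set T}} := [set t : {set T} | (t \subset W) && triangle e t].

Lemma num_triangles_onE W : num_triangles_on e W = #|triangles_on W|.
Proof. by apply: eq_card => t; rewrite !inE. Qed.

Lemma cycles_triangles P W : linear_family e P -> all_cycles_in P ->
  (forall t, t \in P -> t \subset W) ->
  (forall x y, x \in W -> y \in W -> e x y -> covered P x y) ->
  triangles_on W = P.
Proof.
move=> lin cyc PW cov; apply/setP => t; rewrite inE; apply/andP/idP => [[tW t3]|tP]; last first.
  by split; [apply: PW|apply: (proj1 lin)].
have [/and3P[t_uniq ts tc] _] := triangle_cycle t3.
have := cyc _ t_uniq ts; rewrite set_enum; apply.
apply: sub_in_cycle tc; last by apply/allP => x; rewrite mem_enum; apply: (subsetP tW).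
by move=> x y xW yW; apply: cov.
Qed.

(** The union of two triangles with a common edge has no cut vertex, since each of the two shared
    vertices is adjacent to all others. It lies in a block, which has only three vertices, so the
    triangles coincide. *)
Lemma cactus_linear W : nontrivial_components_cactus e W -> linear_family e (triangles_on W).
Proof.
move=> cactus; split=> [t|t t' x y]; first by rewrite inE => /andP[].
rewrite !inE => /andP[tW /triangleP[t3 adj]] /andP[t'W /triangleP[t'3 adj']] xy xt yt xt' yt'.
have xW := subsetP tW x xt; set C := component_on e W x.
have xC : x \in C by rewrite inE xW connect0.
have DC : t :|: t' \subset C.
  have sub (s : {set T}) : s \subset W -> x \in s ->
      (forall a b, a \in s -> b \in s -> a != b -> e a b) -> s \subset C.
    move=> sW xs sadj; apply/subsetP => a as_; have [->//|ax] := eqVneq a x.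
    apply: (component_closed xC); first exact: (subsetP sW).
    by apply: sadj => //; rewrite eq_sym.
  by rewrite subUset !sub.
have star z a : z \in t -> z \in t' -> a \in t :|: t' -> a != z -> e z a.
  by move=> zt zt'; rewrite inE eq_sym => /orP[at_|at_] za; [apply: adj|apply: adj'].
have xD : x \in t :|: t' by rewrite inE xt.
have yD : y \in t :|: t' by rewrite inE yt.
pose Q (S : {set T}) := [/\ S \subset C, connected_on e S & no_cut_vertex_on e S].
have QD : Q (t :|: t').
  split=> //; first by apply: (star_connected xD) => a aD; apply: star.
  move=> r rD; have [rx|rx] := eqVneq r x.
    apply: (@star_connected _ y); first by rewrite in_setD1 yD rx eq_sym xy.
    by move=> a; rewrite in_setD1 => /andP[_ aD]; apply: star.
  apply: (@star_connected _ x); first by rewrite in_setD1 xD eq_sym rx.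
  by move=> a; rewrite in_setD1 => /andP[_ aD]; apply: star.
have [S [DS [SC Sconn Scut] maxS]] := exists_maximal QD.
have [_ blocks] : triangle_cactus_on e C.
  apply: cactus => //; exists x, y; rewrite xC (subsetP DC) ?adj //.
have [S3 _] : is_triangle e S.
  apply: blocks; split=> //; first by apply/set0Pn; exists x; apply: (subsetP DS).
  by move=> S' SS' S'C conn' cut'; apply: maxS.
have eqS (s : {set T}) : s \subset t :|: t' -> #|s| = 3 -> s = S.
  by move=> sD s3; apply/eqP; rewrite eqEcard (subset_trans sD DS) s3 S3.
by rewrite [LHS](eqS t (subsetUl _ _) t3) [RHS](eqS t' (subsetUr _ _) t'3).
Qed.

Lemma card_pairs t : #|t| = 3 -> #|pairs t| = 3.
Proof. by move=> t3; rewrite cards_draws t3. Qed.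

Lemma card_linear_pairs P : linear_family e P -> #|\bigcup_(t in P) pairs t| = 3 * #|P|.
Proof.
move=> lin.
have c3 t : t \in P -> #|pairs t| = 3.
  by move=> /(proj1 lin)/triangleP[t3 _]; apply: card_pairs.
have inj : {in P &, injective (@pairs T)}.
  move=> t t' tP t'P E; apply/eqP/negPn/negP => /(linear_pairs_disjoint lin tP t'P).
  by rewrite -E -setI_eq0 setIid -cards_eq0 c3.
have triv : trivIset (@pairs T @: P).
  apply/trivIsetP => _ _ /imsetP[t tP ->] /imsetP[t' t'P ->] ne.
  by apply: (linear_pairs_disjoint lin) => //; apply: contraNneq ne => ->.
rewrite -cover_imset -(eqP triv) big_imset //= mulnC -sum_nat_const.
by apply: eq_bigr => t /c3.
Qed.

End Blocks.

(** * The main argument *)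

Section HubGraph.
Variables (T : finType) (e : rel T) (v : T).
Hypotheses (e_sym : symmetric e) (e_irr : irreflexive e).
Hypothesis hub : forall u, u != v -> e v u.
Let W : {set T} := ~: [set v].

Lemma spokesP E : E \in spokes v W -> v \in E.
Proof. by case/imsetP => u _ ->; rewrite !inE eqxx. Qed.

Lemma card_spokes : #|spokes v W| = #|T|.-1.
Proof. by rewrite card_in_imset ?cardsC1 // => a b _ _; apply: set2_inj. Qed.

Lemma triangles_avoid_hub (P : {set {set T}}) :
  (forall t, t \in P -> t \subset W) -> forall t, t \in P -> v \notin t.
Proof. by move=> PW t /PW tW; apply/negP => /(subsetP tW); rewrite !inE eqxx. Qed.

Lemma pairs_spokes_disjoint (P : {set {set T}}) : (forall t, t \in P -> t \subset W) ->
  [disjoint \bigcup_(t in P) pairs t & spokes v W].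
Proof.
move=> PW; rewrite -setI_eq0; apply/eqP/setP => E; rewrite in_setI in_set0.
apply/negP => /andP[/bigcupP[t tP]]; rewrite inE => /andP[/subsetP Et _] /spokesP/Et.
by apply/negP; apply: triangles_avoid_hub tP.
Qed.

(** The spokes and the edges of the members are disjoint; counting both yields the converse of the
    equality case. *)
Lemma num_edges_lower (P : {set {set T}}) : linear_family e P ->
  (forall t, t \in P -> t \subset W) -> #|T|.-1 + 3 * #|P| <= num_edges e.
Proof.
move=> lin PW; rewrite -card_spokes -(card_linear_pairs lin) addnC.
have := pairs_spokes_disjoint PW; rewrite -(leq_card_setU _ _).2 => /eqP <-.
apply/subset_leq_card/subsetP => E; rewrite in_setU => /orP[/bigcupP[t tP]|/imsetP[u uW ->]].
  case/pairsP => x [y [xy xt yt ->]]; apply/edge_setP; exists x, y; split=> //.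
  by have [_ adj] := triangleP e t (proj1 lin t tP); apply: adj.
by apply/edge_setP; exists v, u; split=> //; apply: hub; move: uW; rewrite !inE.
Qed.

(** Here [P] is a maximal linear family, [r] counts the edges away from [v] that it leaves
    uncovered, and [s] the cycles made from these and the spokes. A triangle of uncovered edges
    could be added to [P], so [triangle_free_packs] applies to them. *)
Lemma hub_decomposition k : planar e -> ~ has_edge_disjoint_cycles e k ->
  exists P r s, [/\ linear_family e P /\ (forall t, t \in P -> t \subset W),
    num_edges e <= #|T|.-1 + 3 * #|P| + r, #|P| + s < k, r <= (3 * s).-1 &
    r = 0 -> forall x y, x \in W -> y \in W -> e x y -> covered P x y].
Proof.
move=> pl no_k; have [w sides] := planar_sides e_sym pl hub.
pose Q (P : {set {set T}}) := linear_family e P /\ (forall t, t \in P -> t \subset W).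
have Q0 : Q set0 by split; [split=> [t|t t' x y]|move=> t]; rewrite inE.
have [P [_ [lin PW] maxP]] := exists_maximal Q0.
pose h : rel T := fun x y => [&& e x y, x \in W, y \in W & ~~ covered P x y].
have h_sym : symmetric h.
  by move=> x y; rewrite /h /= e_sym [covered P x y]covered_sym andbCA; do !bool_congr.
have he : subrel h e by move=> x y /and4P[].
have tf : triangle_free h.
  move=> x y z hxy hyz; apply/negP => hxz.
  have /and4P[exy xW yW cxy] := hxy; have /and4P[eyz _ zW cyz] := hyz.
  have /and4P[exz _ _ cxz] := hxz.
  have ne a b : e a b -> a != b by apply: contraTneq => ->; rewrite e_irr.
  set t := [set x; y; z].
  have h_t a b : a \in t -> b \in t -> a != b -> h a b.
    rewrite !in_set3 => /or3P[] /eqP-> /or3P[] /eqP->; rewrite ?eqxx // => _; by rewrite h_sym.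
  have tri_t : triangle e t.
    apply/triangleP; split; last by move=> a b at_ bt ab; apply/he/h_t.
    by rewrite /t -setUA cardsU1 cards2 !inE negb_or (ne _ _ exy) (ne _ _ eyz) (ne _ _ exz).
  have no_share a b t' : t' \in P -> a != b -> a \in t -> b \in t -> a \in t' -> b \in t' -> False.
    move=> t'P ab at_ bt at' bt'; have /and4P[_ _ _ /negP] := h_t a b at_ bt ab.
    by apply; apply: covered_in t'P at' bt' ab.
  have QtP : Q (t |: P).
    split; last first.
      move=> t'; rewrite in_setU1 => /orP[/eqP->|/PW //].
      by apply/subsetP => a; rewrite in_set3 => /or3P[] /eqP->.
    split=> [t'|t1 t2 a b]; first by rewrite in_setU1 => /orP[/eqP->//|/(proj1 lin)].
    rewrite !in_setU1 => /orP[/eqP->|t1P] /orP[/eqP->|t2P] ab a1 b1 a2 b2 //.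
    - by case: (no_share a b t2).
    - by case: (no_share a b t1).
    - exact: (proj2 lin t1 t2 a b).
  have tP : t \in P by rewrite -(maxP _ (subsetUr _ _) QtP) setU11.
  by apply: (no_share x y t tP (ne _ _ exy)); rewrite in_set3 eqxx ?orbT.
have hW x y : h x y -> x \in W -> y \in W by case/and4P.
have [s pk_s E_s] := triangle_free_packs e_sym e_irr hub h_sym he tf sides (subxx W) hW.
exists P, #|edges_in h W|, s; split=> //.
- apply: (@leq_trans #|spokes v W :|: \bigcup_(t in P) pairs t :|: edges_in h W|); last first.
    apply: leq_trans (leq_card_setU _ _) _; rewrite leq_add2r.
    apply: leq_trans (leq_card_setU _ _) _.
    by rewrite card_spokes (card_linear_pairs lin).
  apply/subset_leq_card/subsetP => _ /edge_setP[x [y [exy ->]]].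
  rewrite !in_setU.
  have inW a : a != v -> a \in W by rewrite !inE.
  have [xv|/inW xW] := eqVneq x v.
    have yW : y \in W by apply: inW; apply: contraTneq exy => ->; rewrite xv e_irr.
    by rewrite xv (imset_f (fun u => [set v; u]) yW).
  have [yv|/inW yW] := eqVneq y v.
    by rewrite yv setUC (imset_f (fun u => [set v; u]) xW).
  have [cxy|cxy] := boolP (covered P x y).
    have /andP[xy /exists_inP[t tP /andP[xt yt]]] := cxy.
    apply/orP; left; apply/orP; right; apply/bigcupP; exists t => //.
    by apply/pairsP; exists x, y.
  by apply/orP; right; apply/edges_inP; exists x, y; rewrite /h /= exy xW yW cxy.
- rewrite ltnNge; apply/negP => kP; apply: no_k.
  apply: (@packs_has_cycles _ _ (\bigcup_(t in P) pairs t :|: (edges_in h W :|: spokes v W))).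
  apply: packs_sub (packs_cat (linear_packs lin) pk_s _) (subxx _) kP.
  rewrite -setI_eq0 setIUr setU_eq0 !setI_eq0 pairs_spokes_disjoint // andbT.
  rewrite -setI_eq0; apply/eqP/setP => E; rewrite in_setI in_set0.
  apply/negP => /andP[/bigcupP[t tP]]; rewrite inE => /andP[Et _] /edges_inP[x [y [hxy _ _ E1]]].
  move: Et; rewrite E1 subUset !sub1set => /andP[xt yt].
  have /and4P[exy _ _ /negP] := hxy; apply; apply: covered_in tP xt yt _.
  by apply: contraTneq exy => ->; rewrite e_irr.
move=> /eqP; rewrite cards_eq0 => /eqP E0 x y xW yW exy; apply/negPn/negP => cxy.
have : [set x; y] \in edges_in h W by apply/edges_inP; exists x, y; rewrite /h /= exy xW yW cxy.
by rewrite E0 inE.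
Qed.

End HubGraph.

Theorem theorem1p1 (T : finType) (e : rel T) (k : nat) :
  simple_graph e -> 1 <= k -> planar e ->
  (exists v, degree e v = #|T| - 1) ->
  ~ has_edge_disjoint_cycles e k ->
  num_edges e <= #|T| + 3 * k - 4 /\
  (num_edges e = #|T| + 3 * k - 4 <->
   exists v : T,
     [/\ (forall u, u != v -> e v u),
         num_triangles_on e (~: [set v]) = k - 1 &
         nontrivial_components_cactus e (~: [set v])]).
Proof.
move=> [e_sym e_irr] k1 pl [v deg_v] no_k.
have hub u : u != v -> e v u.
  suff NE : [set u | e v u] = ~: [set v].
    by move=> uv; have : u \in [set u | e v u]; [rewrite NE !inE|rewrite inE].
  apply/eqP; rewrite eqEcard cardsC1 -subn1 -[#|[set u | _]|]/(degree e v) deg_v leqnn andbT.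
  by apply/subsetP => x; rewrite !inE; apply: contraTneq => ->; rewrite e_irr.
have T0 : 0 < #|T| by apply/card_gt0P; exists v.
have [P [r [s [[lin PW] ub Psk rs cov]]]] := hub_decomposition e_sym e_irr hub pl no_k.
have bound : num_edges e <= #|T| + 3 * k - 4.
  by move: T0 ub Psk rs k1; clear; move: (num_edges e); card_lia.
split=> //; split=> [full|[v' [hub' triangles cactus]]].
  (* For [s > 0] there are at most 3s - 1 leftover edges and the estimate is strict; hence equality
     forces [s = 0], [r = 0] and a family of full size. *)
  have [r0 Pk] : r = 0 /\ #|P| = k - 1.
    by move: full T0 ub Psk rs k1; clear; move: (num_edges e); card_lia.
  have {}cov := cov r0; exists v.
  (* A bad cycle would give |P| + 1 = k edge-disjoint cycles. *)
  have cyc : all_cycles_in P.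
    apply: NNPP => /(not_all_cycles_packs e_sym lin (triangles_avoid_hub PW) hub)[F].
    by rewrite Pk subn1 prednK // => /packs_has_cycles.
  split=> //; last exact: (cycles_blocks e_sym lin cyc PW cov).
  by rewrite num_triangles_onE (cycles_triangles lin cyc PW cov).
apply/eqP; rewrite eqn_leq bound /=.
(* The apex [v'] may differ from [v], so the lower bound is applied to the triangles of the graph
   without [v']. *)
have lin' := cactus_linear e_sym cactus.
have PW' t : t \in triangles_on e (~: [set v']) -> t \subset ~: [set v'] by rewrite inE => /andP[].
have := num_edges_lower hub' lin' PW'; rewrite -num_triangles_onE triangles.
by move: T0 k1; clear; move: (num_edges e); card_lia.
Qed.
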